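(* Let $k\ge 1$ be an integer and let $\bm\delta=(\delta_1,\dots,\delta_k)$ be a fixed sequence of positive reals. Then \[C^2_k(n)=\tilde{\Theta}\left(n^{\lfloor (k+1)/3\rfloor+1}\right)\quad\text{if } k\equiv 0 \text{ or } 2 \pmod 3,\] and, if $k\equiv 1\pmod 3$, then \[C^2_k(n)=\Omega\left(n^{(k-1)/3}\,u_2(n)\right),\] and for every $\varepsilon>0$, \[C^2_k(n)=O\left(n^{(k-1)/3+\varepsilon}\,u_2(n)\right).\]
   Context: For a fixed sequence $\bm\delta=(\delta_1,\dots,\delta_k)$ of positive reals, a $(k+1)$-tuple $(p_1,\dots,p_{k+1})$ of pairwise distinct points of $\mathbb{R}^d$ is a $k$-chain if $\|p_j-p_{j+1}\|=\delta_j$ for every $1\le j\le k$. $C^d_k(n)$ denotes the maximum number of $k$-chains spanned by a set of $n$ points in $\mathbb{R}^d$. $u_2(n)$ denotes the maximum number of pairs of points at distance exactly $1$ in a set of $n$ points in $\mathbb{R}^2$. Notation: $f(n)=\tilde O(g(n))$ means there are positive constants $c,C$ with $f(n)/g(n)\le C\log^c n$ for all sufficiently large $n$; $f=\tilde\Omega(g)$ means $g=\tilde O(f)$; $f=\tilde\Theta(g)$ means both $f=\tilde O(g)$ and $g=\tilde O(f)$. Implicit constants may depend on $k$, $\bm\delta$ and $\varepsilon$. *)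

(* Defs.v *)
From HB Require Import structures.
From mathcomp Require Import all_boot all_order all_algebra.
From mathcomp Require Import all_classical all_reals all_analysis.
Set Implicit Arguments. Unset Strict Implicit. Unset Printing Implicit Defensive.
Import Order.TTheory GRing.Theory Num.Theory.
Local Open Scope ring_scope.

Definition dist2 (R : realType) (p q : R * R) : R :=
  Num.sqrt ((p.1 - q.1) ^+ 2 + (p.2 - q.2) ^+ 2).

(* Number of k-chains (for distances delta) spanned by the n-point set
   {p i | i < n} (p injective): (k+1)-tuples of pairwise distinct points,
   encoded by injective index maps f : 'I_(k+1) -> 'I_n. *)
Definition nchains (R : realType) (k n : nat) (delta : 'I_k -> R)
  (p : 'I_n -> R * R) : nat :=
  #|[set f : {ffun 'I_k.+1 -> 'I_n} | injectiveb f &&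
     [forall j : 'I_k,
        dist2 (p (f (inord j))) (p (f (inord j.+1))) == delta j]]|.

(* C^2_k(n): maximum of nchains over all sets of n points in R^2
   (the count is at most n^(k+1), so this max is over all achievable values). *)
Definition C2 (R : realType) (k : nat) (delta : 'I_k -> R) (n : nat) : nat :=
  \max_(m < (n ^ k.+1).+1 |
        `[< exists p : 'I_n -> R * R, injective p /\ nchains delta p = m >])
     (val m).

Definition nunit (R : realType) (n : nat) (p : 'I_n -> R * R) : nat :=
  #|[set ij : 'I_n * 'I_n | (ij.1 < ij.2)%N && (dist2 (p ij.1) (p ij.2) == 1)]|.

Definition u2 (R : realType) (n : nat) : nat :=
  \max_(m < (n ^ 2).+1 |
        `[< exists p : 'I_n -> R * R, injective p /\ nunit p = m >])
     (val m).

Definition isBigO (R : realType) (f g : nat -> R) : Prop :=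
  exists C : R, 0 < C /\ exists N : nat, forall n : nat, (N <= n)%N ->
    f n <= C * g n.

Definition isSoftO (R : realType) (f g : nat -> R) : Prop :=
  exists c C : R, 0 < c /\ 0 < C /\ exists N : nat, forall n : nat, (N <= n)%N ->
    f n <= C * (ln (n%:R : R)) `^ c * g n.

Definition softTheta (R : realType) (f g : nat -> R) : Prop :=
  isSoftO f g /\ isSoftO g f.

(* Main.v *)
(* Upper bound.  Lower half-circles of a fixed radius are graphs of translates of
   one convex function, so the difference of two of them is monotone and they
   behave like pseudo-lines.  Joining consecutive points on every arc gives a
   drawing with x-monotone edges; a charging argument bounds the number of edges
   of a crossing-free drawing linearly, random sampling of the points turns this
   into the crossing inequality, and the Szemeredi-Trotter bound
   I = O(a^(2/3) b^(2/3) + a + b) for a circles of equal radius and b points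
   follows.

   Chains are then counted in blocks of three edges.  Let L be the set of current
   end points and sort the next vertices into dyadic classes according to their
   number of neighbours in L, and so on along the block.  Let U >= n bound the
   number of incidences between any two sets of at most n points, let W bound the
   number of partial chains ending at a point of L, divided by n for every block
   already passed, and put V = n W.  The invariant is

     V <= C n   or   (V <= C U and V^3 |L|^2 <= C U^3 n),

   which guarantees that V times the number of incidences of L with n points is
   O(n U).  After taking logarithms, its preservation along one block is a linear
   programming problem over finitely many cases.  The only other ingredient is that
   two circles with different centres meet in at most two points, so that in a chain
   x, y, z the ends x and z leave at most two choices for y.

   Lower bound.  A block of three edges is realised by a vertex p moving on a
   circle around a fixed centre c, followed by a point b with |bc| and |bv|
   prescribed, which exists for every v close to a fixed position (a four-bar
   linkage); this multiplies the number of chains by n.  For k = 1 mod 3 the last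
   edge is taken from an extremal unit distance configuration, which is first
   folded modulo a generic lattice of small mesh so that one end of a positive
   proportion of the edges lies in a small square. *)
Require Import Defs.
From HB Require Import structures.
From mathcomp Require Import all_boot all_order all_algebra.
From mathcomp Require Import boolp ring lra zify.
Set Implicit Arguments. Unset Strict Implicit. Unset Printing Implicit Defensive.
Import Order.TTheory GRing.Theory Num.Theory.
Local Open Scope ring_scope.

(** * Incidences of pseudo-arcs *)

(** Choosing a partner for every element of [E] gives an injection into [F]. With a relation in
    place of a function, charging schemes can be described case by case through existential
    witnesses. *)
Lemma leq_card_rel (A B : finType) (E : {set A}) (F : {set B})
    (r : A -> B -> Prop) :
  (forall e, e \in E -> exists2 c, c \in F & r e c) ->
  (forall e e' c, e \in E -> e' \in E -> r e c -> r e' c -> e = e') ->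
  (#|E| <= #|F|)%N.
Proof.
move=> tot inj; have [->|[e0 e0E]] := set_0Vmem E; first by rewrite cards0.
have [c0 _ _] := tot _ e0E.
have /choice[phi phiP] :
    forall e, exists c, e \in E -> c \in F /\ r e c.
  move=> e; have [/tot[c cF ec]|neE] := boolP (e \in E); first by exists c.
  by exists c0.
have inj_phi : {in E &, injective phi}.
  move=> e e' eE e'E phi_eq; have [_ r1] := phiP _ eE; have [_ r2] := phiP _ e'E.
  by apply: (inj e e' (phi e)) => //; rewrite phi_eq.
rewrite -(card_in_imset inj_phi); apply/subset_leq_card/subsetP => _ /imsetP[e eE ->].
by case: (phiP _ eE).
Qed.

Lemma sum_card_exchange (A B : finType) (S : {set B}) (p : A -> B -> bool) :
  (\sum_(a : A) #|[set b in S | p a b]| = \sum_(b in S) #|[set a | p a b]|)%N.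
Proof.
under eq_bigr do rewrite -sum1dep_card big_mkcondr /=.
rewrite exchange_big /=; apply: eq_bigr => b _.
by rewrite -big_mkcond sum1dep_card.
Qed.

(** For a uniformly random colouring [f] this says that all of [A] receives colour [0] with
    probability [(q+1)^-|A|]; clearing denominators keeps the sampling argument in [nat]. *)
Lemma card_vanishing (T : finType) (q : nat) (A : {set T}) :
  (#|[set f : {ffun T -> 'I_q.+1} | [forall x in A, f x == ord0]]| * q.+1 ^ #|A|
   = q.+1 ^ #|T|)%N.
Proof.
have -> : #|[set f : {ffun T -> 'I_q.+1} | [forall x in A, f x == ord0]]|
    = #|family (fun x : T => if x \in A then pred1 (ord0 : 'I_q.+1) else predT)|.
  rewrite cardsE; apply: eq_card => f; rewrite [LHS]inE.
  apply/forall_inP/familyP => fA x; first by case: ifPn => // /fA.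
  by move=> xA; have := fA x; rewrite xA.
rewrite card_family foldrE big_map big_enum /=.
have -> : (\prod_(x : T) #|(if x \in A then pred1 (ord0 : 'I_q.+1) else predT)|
    = \prod_(x in ~: A) q.+1)%N.
  rewrite [RHS]big_mkcond /=; apply: eq_bigr => x _; rewrite inE.
  by case: (x \in A) => /=; rewrite ?card1 ?card_ord.
by rewrite prod_nat_const -expnD addnC cardsC.
Qed.

Section PseudoArcs.
Variables (R : realDomainType) (P C : finType) (X Y : P -> R).
Variables (h : C -> R -> R) (dom : C -> R -> bool) (key : C -> R).
Hypothesis XY_inj : forall u v, X u = X v -> Y u = Y v -> u = v.
Hypothesis dom_convex :
  forall q x y z, dom q x -> dom q z -> x <= y -> y <= z -> dom q y.
(** For circles, [key] will be the abscissa of the centre. Arcs with distinct keys have a strictly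
    monotone difference, hence meet at most once; arcs with equal keys are disjoint and keep their
    vertical order. *)
Hypothesis h_key_lt : forall q q' x y, dom q x -> dom q y -> dom q' x -> dom q' y ->
  key q < key q' -> x < y -> h q x - h q' x < h q y - h q' y.
Hypothesis h_key_eq : forall q q' x y, dom q x -> dom q y -> dom q' x -> dom q' y ->
  key q = key q' -> q != q' -> h q x <= h q' x -> h q y < h q' y.

Definition on_arc (q : C) (u : P) := dom q (X u) && (Y u == h q (X u)).

(* An edge (q, (u, v)) is the piece of the arc q between two points u, v that
   are consecutive on q. *)
Definition is_edge (V : {set P}) (e : C * (P * P)) :=
  [&& on_arc e.1 e.2.1, on_arc e.1 e.2.2, e.2.1 \in V, e.2.2 \in V,
      X e.2.1 < X e.2.2 &
      [forall z in V, ~~ [&& on_arc e.1 z, X e.2.1 < X z & X z < X e.2.2]]].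

(** [lo] and [hi] bound the common range of abscissae. Only a strict reversal of the vertical order
    between them counts, so edges that merely share an end point do not cross. *)
Definition crosses (e e' : C * (P * P)) :=
  let lo := Num.max (X e.2.1) (X e'.2.1) in
  let hi := Num.min (X e.2.2) (X e'.2.2) in
  (lo < hi) &&
  ((h e.1 lo < h e'.1 lo) && (h e'.1 hi < h e.1 hi) ||
   (h e'.1 lo < h e.1 lo) && (h e.1 hi < h e'.1 hi)).

Lemma edge_dom V e x : is_edge V e -> X e.2.1 <= x -> x <= X e.2.2 -> dom e.1 x.
Proof.
case/and5P => /andP[d1 _] /andP[d2 _] _ _ _ x1 x2.
exact: dom_convex d1 d2 x1 x2.
Qed.

Lemma edge_dom_l V e : is_edge V e -> dom e.1 (X e.2.1).
Proof. by case/and5P => /andP[]. Qed.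

Lemma edge_dom_r V e : is_edge V e -> dom e.1 (X e.2.2).
Proof. by case/and5P => _ /andP[]. Qed.

Lemma edge_dom2 V e x y : is_edge V e -> X e.2.1 <= x -> x < y -> y <= X e.2.2 ->
  dom e.1 x /\ dom e.1 y.
Proof.
move=> He x1 xy y2; split; apply: (edge_dom He) => //.
  exact: ltW (lt_le_trans xy y2).
exact: ltW (le_lt_trans x1 xy).
Qed.

Lemma edge_l V e : is_edge V e -> h e.1 (X e.2.1) = Y e.2.1.
Proof. by case/and5P => /andP[_ /eqP]. Qed.

Lemma edge_r V e : is_edge V e -> h e.1 (X e.2.2) = Y e.2.2.
Proof. by case/and5P => _ /andP[_ /eqP]. Qed.

Lemma edge_lt V e : is_edge V e -> X e.2.1 < X e.2.2.
Proof. by case/and5P => _ _ _ _ /andP[]. Qed.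

Lemma edge_inV V e : is_edge V e -> (e.2.1 \in V) * (e.2.2 \in V).
Proof. by case/and5P => _ _ -> -> _. Qed.

Lemma edge_empty V e z : is_edge V e -> z \in V ->
  h e.1 (X z) = Y z -> X e.2.1 < X z -> X z < X e.2.2 -> False.
Proof.
move=> He zV hz z1 z2; have := He.
case/and5P => _ _ _ _ /andP[_ /forall_inP/(_ z zV)] /negP; apply.
rewrite /on_arc hz eqxx z1 z2 !andbT.
by apply: edge_dom He _ _; apply: ltW.
Qed.

Lemma arc_sep q q' x y : dom q x -> dom q y -> dom q' x -> dom q' y ->
  key q < key q' -> h q x = h q' x -> x < y -> h q' y < h q y.
Proof. by move=> a b c d k hx xy; have := h_key_lt a b c d k xy; lra. Qed.

Lemma arc_sepl q q' x y : dom q x -> dom q y -> dom q' x -> dom q' y ->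
  key q < key q' -> h q x = h q' x -> y < x -> h q y < h q' y.
Proof. by move=> a b c d k hx xy; have := h_key_lt b a d c k xy; lra. Qed.

Lemma arc_key_inj q q' x : dom q x -> dom q' x -> h q x = h q' x ->
  key q = key q' -> q = q'.
Proof.
move=> d d' hx k; apply/eqP/negPn/negP => /(h_key_eq d d d' d' k).
by rewrite hx lexx ltxx => /(_ isT).
Qed.

(** If [e] has the smaller key, the difference [h e.1 - h e'.1] increases, so it is negative at [x0]
    once it is negative at [x1]. If [e] has the larger key, a positive value at [x0] and a negative
    one at [x1] persist out to [lo] and [hi], which is a crossing. Equal keys fix the order. *)
Lemma nocross_le V V' e e' x0 x1 : is_edge V e -> is_edge V' e' -> ~~ crosses e e' ->
  X e.2.1 <= x0 -> X e'.2.1 <= x0 -> x0 <= x1 -> x1 <= X e.2.2 -> x1 <= X e'.2.2 ->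
  h e.1 x1 < h e'.1 x1 -> h e.1 x0 <= h e'.1 x0.
Proof.
move=> He He' nc a1 a2 a3 a4 a5 hlt; rewrite leNgt; apply/negP => hgt.
have x01 : x0 < x1.
  by rewrite lt_neqAle a3 andbT; apply/eqP => x01; move: hgt; rewrite x01; lra.
have [d0 d1] : dom e.1 x0 /\ dom e.1 x1.
  by split; apply: (edge_dom He); lra.
have [d0' d1'] : dom e'.1 x0 /\ dom e'.1 x1.
  by split; apply: (edge_dom He'); lra.
have [k|k|k] := ltgtP (key e.1) (key e'.1).
- by have := h_key_lt d0 d1 d0' d1' k x01; lra.
- move: nc; rewrite /crosses; set lo := Num.max _ _; set hi := Num.min _ _.
  have lo0 : lo <= x0 by rewrite ge_max a1.
  have hi1 : x1 <= hi by rewrite le_min a4.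
  have lo_l : X e.2.1 <= lo by rewrite le_max lexx.
  have lo_l' : X e'.2.1 <= lo by rewrite le_max lexx orbT.
  have hi_r : hi <= X e.2.2 by rewrite ge_min lexx.
  have hi_r' : hi <= X e'.2.2 by rewrite ge_min lexx orbT.
  have [dl dh] : dom e.1 lo /\ dom e.1 hi by split; apply: (edge_dom He); lra.
  have [dl' dh'] : dom e'.1 lo /\ dom e'.1 hi by split; apply: (edge_dom He'); lra.
  have hlo : h e'.1 lo < h e.1 lo.
    move: lo0; rewrite le_eqVlt => /orP[/eqP->//|lo0].
    by have := h_key_lt dl' d0' dl d0 k lo0; lra.
  have hhi : h e.1 hi < h e'.1 hi.
    move: hi1; rewrite le_eqVlt => /orP[/eqP<-//|hi1].
    by have := h_key_lt d1' dh' d1 dh k hi1; lra.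
  by rewrite hlo hhi orbT andbT => /negP; apply; lra.
- have [qq|nq] := eqVneq e.1 e'.1; first by move: hgt; rewrite qq ltxx.
  by have := h_key_eq d1 d0 d1' d0' k nq (ltW hlt); lra.
Qed.

(** * Crossing-free drawings have linearly many edges *)

Section Planar.
Variables (V : {set P}) (E : {set C * (P * P)}).
Hypothesis E_edge : forall e, e \in E -> is_edge V e.
Hypothesis E_nc : forall e e', e \in E -> e' \in E -> ~~ crosses e e'.

(** Two arcs with equal keys through a common point coincide, and on one arc the edge leaving a
    given point is determined, because no point of [V] on the arc lies strictly inside an edge. *)
Lemma edge_eq_l e f : e \in E -> f \in E -> e.2.1 = f.2.1 -> key e.1 = key f.1 -> e = f.
Proof.
move=> eE fE uu kk; have He := E_edge eE; have Hf := E_edge fE.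
have qq : e.1 = f.1.
  apply: (@arc_key_inj _ _ (X e.2.1)) kk.
  - exact: edge_dom_l He.
  - by rewrite uu; exact: edge_dom_l Hf.
  - by rewrite (edge_l He) uu (edge_l Hf).
have He' := edge_lt He; have Hf' := edge_lt Hf.
have [l|l|l] := ltgtP (X e.2.2) (X f.2.2).
- exfalso; apply: (edge_empty Hf (edge_inV He).2) => //; first by rewrite -qq (edge_r He).
  by rewrite -uu.
- exfalso; apply: (edge_empty He (edge_inV Hf).2) => //; first by rewrite qq (edge_r Hf).
  by rewrite uu.
- have vv : e.2.2 = f.2.2.
    by apply: XY_inj => //; rewrite -(edge_r He) -(edge_r Hf) qq l.
  by move: qq uu vv; case: (e) (f) => [? [? ?]] [? [? ?]] /= -> -> ->.
Qed.

Lemma edge_eq_r e f : e \in E -> f \in E -> e.2.2 = f.2.2 -> key e.1 = key f.1 -> e = f.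
Proof.
move=> eE fE uu kk; have He := E_edge eE; have Hf := E_edge fE.
have qq : e.1 = f.1.
  apply: (@arc_key_inj _ _ (X e.2.2)) kk.
  - exact: edge_dom_r He.
  - by rewrite uu; exact: edge_dom_r Hf.
  - by rewrite (edge_r He) uu (edge_r Hf).
have He' := edge_lt He; have Hf' := edge_lt Hf.
have [l|l|l] := ltgtP (X e.2.1) (X f.2.1).
- exfalso; apply: (edge_empty He (edge_inV Hf).1) => //; first by rewrite qq (edge_l Hf).
  by rewrite uu.
- exfalso; apply: (edge_empty Hf (edge_inV He).1) => //; first by rewrite -qq (edge_l He).
  by rewrite -uu.
- have vv : e.2.1 = f.2.1.
    by apply: XY_inj => //; rewrite -(edge_l He) -(edge_l Hf) qq l.
  by move: qq uu vv; case: (e) (f) => [? [? ?]] [? [? ?]] /= -> -> ->.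
Qed.

(* Among the edges leaving a point to the right, a larger key means a lower edge;
   so e' is the edge immediately below e at their common left end. *)
Definition next_below (e e' : C * (P * P)) :=
  [/\ e' \in E, e'.2.1 = e.2.1, key e.1 < key e'.1 &
      forall f, f \in E -> f.2.1 = e.2.1 -> key e.1 < key f.1 -> key e'.1 <= key f.1].

(** The closed region between the upper edge [e] and the lower edge [e'], without their apex and cut
    off where the first of them ends. *)
Definition in_wedge (e e' : C * (P * P)) (z : P) :=
  [&& z \in V, X e.2.1 < X z, X z <= X e.2.2, X z <= X e'.2.2,
      h e'.1 (X z) <= Y z & Y z <= h e.1 (X z)].

Definition leftmost (e e' : C * (P * P)) (w : P) :=
  in_wedge e e' w /\ forall z, in_wedge e e' z -> X w <= X z.

Lemma wedge_strict e e' x : e \in E -> next_below e e' ->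
  X e.2.1 < x -> x <= X e.2.2 -> x <= X e'.2.2 -> h e'.1 x < h e.1 x.
Proof.
move=> eE [e'E uu k _] x1 x2 x3; have He := E_edge eE; have He' := E_edge e'E.
have [d1 d2] := edge_dom2 He (lexx _) x1 x2.
have [d1' d2'] : dom e'.1 (X e.2.1) /\ dom e'.1 x.
  by apply: (edge_dom2 He') => //; rewrite uu.
by apply: (arc_sep d1) => //; rewrite (edge_l He) -uu (edge_l He').
Qed.

(** Whichever of the two edges ends first contributes its right end to the wedge, so the minimum is
    over a nonempty set. *)
Lemma leftmost_exists e e' : e \in E -> next_below e e' -> exists w, leftmost e e' w.
Proof.
move=> eE ne; have [e'E uu k _] := ne; have He := E_edge eE; have He' := E_edge e'E.
have [z0 z0W] : exists z, in_wedge e e' z.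
  have := edge_lt He; have := edge_lt He'; rewrite uu => l' l.
  have [vv|/ltW vv] := leP (X e.2.2) (X e'.2.2).
    exists e.2.2; rewrite /in_wedge (edge_inV He) l lexx vv /=.
    by rewrite (edge_r He) lexx andbT -(edge_r He) ltW // (wedge_strict eE ne).
  exists e'.2.2; rewrite /in_wedge (edge_inV He') l' lexx vv /=.
  by rewrite (edge_r He') lexx /= -(edge_r He') ltW // (wedge_strict eE ne).
case: (arg_minP X z0W) => w wW wmin; exists w; split => // z zW; exact: wmin.
Qed.

(** If [f] started right of the apex, its left end would be a wedge point to the left of [w]. If it
    started left of the apex, it would pass through the apex, a point of [V] strictly inside an
    edge. *)
Lemma wedge_trap e e' w f : e \in E -> next_below e e' -> leftmost e e' w ->
  f \in E -> X f.2.1 < X w -> X w <= X f.2.2 ->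
  (forall x, X e.2.1 <= x -> X f.2.1 <= x -> x < X w ->
     h e'.1 x <= h f.1 x <= h e.1 x) ->
  f.2.1 = e.2.1.
Proof.
move=> eE ne [wW wmin] fE fw wf between.
have [e'E uu k _] := ne.
have He := E_edge eE; have He' := E_edge e'E; have Hf := E_edge fE.
have /and5P[wV uw wv wv' _] := wW.
have [l|l] := ltP (X e.2.1) (X f.2.1).
  exfalso; suff W : in_wedge e e' f.2.1 by have := wmin _ W; lra.
  have /andP[b1 b2] := between _ (ltW l) (lexx _) fw.
  rewrite /in_wedge (edge_inV Hf) l -(edge_l Hf) b1 b2 /= andbT.
  by apply/andP; split; lra.
have := between _ (lexx _) l uw.
have Hl : h e'.1 (X e.2.1) = Y e.2.1 by rewrite -uu (edge_l He').
rewrite (edge_l He) Hl => hf.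
have {}hf : h f.1 (X e.2.1) = Y e.2.1 by lra.
move: l; rewrite le_eqVlt => /orP[/eqP l|l].
  by apply: XY_inj => //; rewrite -(edge_l Hf) l.
exfalso; apply: (edge_empty Hf (edge_inV He).1) => //; lra.
Qed.

(** If the two lower edges differ, they meet at [w], and the upper one of them is squeezed into the
    other wedge; [wedge_trap] then gives it the same apex, so the two arcs meet twice. If they
    agree, both upper edges are the immediate successor of one edge at one vertex. *)
Lemma inj_type1 e1 e1' e2 e2' w : e1 \in E -> e2 \in E ->
  next_below e1 e1' -> next_below e2 e2' ->
  leftmost e1 e1' w -> leftmost e2 e2' w -> e1'.2.2 = w -> e2'.2.2 = w -> e1 = e2.
Proof.
wlog k : e1 e1' e2 e2' / key e1'.1 <= key e2'.1.
  move=> W E1 E2 n1 n2 l1 l2 v1 v2; have [k|/ltW k] := leP (key e1'.1) (key e2'.1).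
    exact: (W e1 e1' e2 e2').
  by apply/esym; exact: (W e2 e2' e1 e1').
move=> E1 E2 n1 n2 l1 l2 v1 v2.
have [E1' u1 k1 m1] := n1; have [E2' u2 k2 m2] := n2.
have H1 := E_edge E1; have H2 := E_edge E2.
have H1' := E_edge E1'; have H2' := E_edge E2'.
have /and5P[wV w1 w2 w3 _] := l1.1; have /and5P[_ w1' w2' w3' _] := l2.1.
have hw1 : h e1'.1 (X w) = Y w by rewrite -v1 (edge_r H1').
have hw2 : h e2'.1 (X w) = Y w by rewrite -v2 (edge_r H2').
move: k; rewrite le_eqVlt => /orP[/eqP k|k]; last first.
  exfalso.
  have sep x : X e1'.2.1 <= x -> X e2'.2.1 <= x -> x < X w -> h e1'.1 x < h e2'.1 x.
    move=> x1 x2 xw; have [d1 d2] := edge_dom2 H1' x1 xw w3.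
    have [d1' d2'] := edge_dom2 H2' x2 xw w3'.
    by apply: (arc_sepl d2) => //; rewrite hw1 hw2.
  have uu : e2'.2.1 = e1.2.1.
    apply: (wedge_trap E1 n1 l1 E2') => //; first by rewrite u2.
    move=> x x1 x2 xw; apply/andP; split; first by rewrite ltW // sep ?u1.
    apply: (nocross_le H2' H1 (E_nc E2' E1) x2 x1 (ltW xw) w3' w2).
    by rewrite hw2 -hw1; apply: (wedge_strict E1 n1).
  have := sep (X e1.2.1).
  by rewrite u1 -uu lexx uu => /(_ isT isT w1);
    rewrite -{2}uu (edge_l H2') uu -u1 (edge_l H1') ltxx.
have e'e' : e1' = e2' by apply: edge_eq_r => //; rewrite v1 v2.
move: n2 u2 k2 m2; rewrite -e'e' => n2 u2 k2 m2.
have uu : e1.2.1 = e2.2.1 by rewrite -u1 u2.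
apply: edge_eq_l => //; have [kk|kk|//] := ltgtP (key e1.1) (key e2.1).
  by have := le_lt_trans (m1 _ E2 (esym uu) kk) k2; rewrite e'e' ltxx.
by have := le_lt_trans (m2 _ E1 uu kk) k1; rewrite e'e' ltxx.
Qed.

(** The mirror situation: if the upper edges ending at [w] differ, the lower of them is trapped in
    the wedge of the other, and the two arcs meet both at the apex and at [w]. *)
Lemma inj_type2 e1 e1' e2 e2' w : e1 \in E -> e2 \in E ->
  next_below e1 e1' -> next_below e2 e2' ->
  leftmost e1 e1' w -> leftmost e2 e2' w -> e1.2.2 = w -> e2.2.2 = w -> e1 = e2.
Proof.
wlog k : e1 e1' e2 e2' / key e2.1 <= key e1.1.
  move=> W E1 E2 n1 n2 l1 l2 v1 v2; have [k|/ltW k] := leP (key e2.1) (key e1.1).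
    exact: (W e1 e1' e2 e2' k E1 E2 n1 n2 l1 l2).
  by apply/esym; exact: (W e2 e2' e1 e1' k E2 E1 n2 n1 l2 l1).
move=> E1 E2 n1 n2 l1 l2 v1 v2.
have [E1' u1 k1 m1] := n1; have [E2' u2 k2 m2] := n2.
have H1 := E_edge E1; have H2 := E_edge E2.
have H1' := E_edge E1'; have H2' := E_edge E2'.
have /and5P[wV w1 w2 w3 _] := l1.1; have /and5P[_ w1' w2' w3' _] := l2.1.
have hw1 : h e1.1 (X w) = Y w by rewrite -v1 (edge_r H1).
have hw2 : h e2.1 (X w) = Y w by rewrite -v2 (edge_r H2).
move: k; rewrite le_eqVlt => /orP[/eqP k|k].
  by apply: edge_eq_r; rewrite ?v1 ?v2.
exfalso.
have sep x : X e1.2.1 <= x -> X e2.2.1 <= x -> x < X w -> h e2.1 x < h e1.1 x.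
  move=> x1 x2 xw; have [d1 d2] := edge_dom2 H1 x1 xw w2.
  have [d1' d2'] := edge_dom2 H2 x2 xw w2'.
  by apply: (arc_sepl d2') => //; rewrite hw1 hw2.
have uu : e2.2.1 = e1.2.1.
  apply: (wedge_trap E1 n1 l1 E2) => // x x1 x2 xw.
  apply/andP; split; last by rewrite ltW // sep.
  apply: (nocross_le H1' H2 (E_nc E1' E2) _ x2 (ltW xw) w3 w2'); first by rewrite u1.
  by rewrite hw2 -hw1; apply: (wedge_strict E1 n1).
have := sep (X e1.2.1).
by rewrite -uu lexx uu => /(_ isT isT w1); rewrite -{1}uu (edge_l H2) uu (edge_l H1) ltxx.
Qed.

Lemma leftmost_strict e e' w : e \in E -> next_below e e' -> leftmost e e' w ->
  e.2.2 <> w -> e'.2.2 <> w -> h e'.1 (X w) < Y w /\ Y w < h e.1 (X w).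
Proof.
move=> eE ne [/and5P[wV uw wv wv' /andP[b1 b2]] _] nv nv'.
have [e'E uu _ _] := ne; have He := E_edge eE; have He' := E_edge e'E.
split; rewrite lt_neqAle ?b1 ?b2 andbT; apply/eqP => hw.
  move: wv'; rewrite le_eqVlt => /orP[/eqP wv'|wv'].
    by apply: nv'; apply: XY_inj => //; rewrite -(edge_r He') -wv'.
  by apply: (edge_empty He' wV) => //; rewrite uu.
move: wv; rewrite le_eqVlt => /orP[/eqP wv|wv].
  by apply: nv; apply: XY_inj => //; rewrite -(edge_r He) -wv.
by apply: (edge_empty He wV) => //.
Qed.

(** Here [w] is strictly inside both wedges. Without crossings, the apex further to the right lies
    in the other wedge, so by minimality of [w] the apices coincide; but wedges between consecutive
    edges at one vertex do not overlap. *)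
Lemma inj_type3 e1 e1' e2 e2' w : e1 \in E -> e2 \in E ->
  next_below e1 e1' -> next_below e2 e2' ->
  leftmost e1 e1' w -> leftmost e2 e2' w ->
  e1.2.2 <> w -> e2.2.2 <> w -> e1'.2.2 <> w -> e2'.2.2 <> w -> e1 = e2.
Proof.
wlog l : e1 e1' e2 e2' / X e1.2.1 <= X e2.2.1.
  move=> W E1 E2 n1 n2 l1 l2 *; have [l|/ltW l] := leP (X e1.2.1) (X e2.2.1).
    exact: (W e1 e1' e2 e2').
  by apply/esym; exact: (W e2 e2' e1 e1').
move=> E1 E2 n1 n2 l1 l2 v1 v2 v1' v2'.
have [E1' u1 k1 m1] := n1; have [E2' u2 k2 m2] := n2.
have H1 := E_edge E1; have H2 := E_edge E2.
have H1' := E_edge E1'; have H2' := E_edge E2'.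
have /and5P[wV w1 w2 w3 _] := l1.1; have /and5P[_ w1' w2' w3' _] := l2.1.
have [b1' b1] := leftmost_strict E1 n1 l1 v1 v1'.
have [b2' b2] := leftmost_strict E2 n2 l2 v2 v2'.
have c1 : h e1'.1 (X e2.2.1) <= Y e2.2.1.
  rewrite -(edge_l H2); apply: (nocross_le H1' H2 (E_nc E1' E2) _ _ (ltW w1') w3 w2') => //.
    by rewrite u1.
  exact: lt_trans b1' b2.
have c2 : Y e2.2.1 <= h e1.1 (X e2.2.1).
  rewrite -u2 -(edge_l H2') u2.
  apply: (nocross_le H2' H1 (E_nc E2' E1) _ _ (ltW w1') w3' w2) => //.
    by rewrite u2.
  exact: lt_trans b2' b1.
have uu : e1.2.1 = e2.2.1.
  move: l; rewrite le_eqVlt => /orP[/eqP l|l]; last first.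
    exfalso; suff W : in_wedge e1 e1' e2.2.1.
      by have := le_lt_trans (l1.2 _ W) w1'; rewrite ltxx.
    by rewrite /in_wedge (edge_inV H2) l c1 c2 /= !ltW // (lt_le_trans w1').
  apply: XY_inj => //; move: c1 c2.
  rewrite -l (edge_l H1) -[X in X.2.1]/e1 -u1 (edge_l H1') u1 => c1 c2.
  by apply: le_anti; rewrite c1.
apply: edge_eq_l => //; have [kk|kk|//] := ltgtP (key e1.1) (key e2.1); exfalso.
  have := m1 _ E2 (esym uu) kk; rewrite le_eqVlt => /orP[/eqP k|k].
    have ee : e1' = e2 by apply: edge_eq_l => //; rewrite u1 uu.
    by move: b1'; rewrite ee ltNge ltW.
  have [d1 d2] := edge_dom2 H2 (lexx _) w1' w2'.
  have [d1' d2'] : dom e1'.1 (X e2.2.1) /\ dom e1'.1 (X w).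
    by apply: (edge_dom2 H1'); rewrite ?u1 ?uu.
  have : h e2.1 (X w) < h e1'.1 (X w).
    by apply: (arc_sep d1') => //; rewrite (edge_l H2) -uu -u1 (edge_l H1').
  by move/(lt_trans b2)/lt_trans/(_ b1'); rewrite ltxx.
have := m2 _ E1 uu kk; rewrite le_eqVlt => /orP[/eqP k|k].
  have ee : e2' = e1 by apply: edge_eq_l => //; rewrite u2 uu.
  by move: b2'; rewrite ee ltNge ltW.
have [d1 d2] := edge_dom2 H1 (lexx _) w1 w2.
have [d1' d2'] : dom e2'.1 (X e1.2.1) /\ dom e2'.1 (X w).
  by apply: (edge_dom2 H2'); rewrite ?u2 -?uu.
have : h e1.1 (X w) < h e2'.1 (X w).
  by apply: (arc_sep d1') => //; rewrite (edge_l H1) uu -u2 (edge_l H2').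
by move/(lt_trans b1)/lt_trans/(_ b2'); rewrite ltxx.
Qed.

(* An edge is charged to its left end if it is the lowest edge there, and otherwise
   to the leftmost point w of the wedge between it and the next lower edge.  The
   label tells whether w ends the lower edge (1), the upper edge (2) or neither (3);
   together with it the charge determines the edge. *)
Definition charge (e : C * (P * P)) (c : P * 'I_4) : Prop :=
  match val c.2 with
  | 0 => e.2.1 = c.1 /\ forall f, f \in E -> f.2.1 = e.2.1 -> key f.1 <= key e.1
  | 1 => exists e', [/\ next_below e e', leftmost e e' c.1 & e'.2.2 = c.1]
  | 2 => exists e', [/\ next_below e e', leftmost e e' c.1 & e.2.2 = c.1]
  | _ => exists e', [/\ next_below e e', leftmost e e' c.1, e.2.2 <> c.1 & e'.2.2 <> c.1]
  end.

Lemma card_planar : (#|E| <= 4 * #|V|)%N.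
Proof.
have -> : (4 * #|V|)%N = #|setX V [set: 'I_4]| by rewrite cardsX cardsT card_ord mulnC.
apply: (@leq_card_rel _ _ _ _ charge); last first.
  move=> e1 e2 [w [[|[|[|i]]] /= ?]] E1 E2; rewrite /charge /=.
  - move=> [u1 m1] [u2 m2]; apply: edge_eq_l; rewrite ?u1 ?u2 //.
    by apply: le_anti; rewrite m1 ?m2 ?u1 ?u2.
  - by move=> [e1' [? ? ?]] [e2' [? ? ?]]; apply: inj_type1; eassumption.
  - move=> [e1' [n1 l1 ?]] [e2' [n2 l2 ?]]; exact: (inj_type2 E1 E2 n1 n2 l1 l2).
  - move=> [e1' [n1 l1 ? ?]] [e2' [n2 l2 ? ?]]; exact: (inj_type3 E1 E2 n1 n2 l1 l2).
move=> e eE; have He := E_edge eE.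
pose below := [pred f | [&& f \in E, f.2.1 == e.2.1 & key e.1 < key f.1]].
have [f0 f0b|nob] := pickP below; last first.
  exists (e.2.1, ord0); first by rewrite !inE (edge_inV He).
  split=> //= f fE uu; rewrite leNgt; apply/negP => k.
  by have := nob f; rewrite /= fE uu eqxx k.
have [e' /and3P[e'E /eqP uu k] e'min] := arg_minP (fun f => key f.1) f0b.
have ne : next_below e e'.
  by split=> // f fE fu fk; apply: e'min; rewrite /= fE fu eqxx.
have [w wl] := leftmost_exists eE ne.
have wV : w \in V by case/and5P: wl.1.
have [ww|nw] := eqVneq e'.2.2 w.
  by exists (w, inord 1); rewrite ?inE ?wV // /charge /= inordK //; exists e'.
have [ww'|nw'] := eqVneq e.2.2 w.
  by exists (w, inord 2); rewrite ?inE ?wV // /charge /= inordK //; exists e'.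
exists (w, inord 3); rewrite ?inE ?wV // /charge /= inordK //; exists e'.
by split=> //; apply/eqP.
Qed.

End Planar.

(** * The crossing inequality by random sampling *)

Definition crossings (E : {set C * (P * P)}) :=
  [set x : (C * (P * P)) * (C * (P * P)) |
    [&& x.1 \in E, x.2 \in E & crosses x.1 x.2]].

(** Deleting an edge that takes part in a crossing lowers the number of crossings by at least one;
    when none is left, the planar bound applies. *)
Lemma card_edges_crossings (V : {set P}) (E : {set C * (P * P)}) :
  (forall e, e \in E -> is_edge V e) -> (#|E| <= 4 * #|V| + #|crossings E|)%N.
Proof.
elim: {E}_.+1 {-2}E (ltnSn #|E|) => // n IH E En E_edge.
have [nc|[[e e'] cr]] := set_0Vmem (crossings E).
  rewrite nc cards0 addn0.
  apply: (card_planar E_edge) => e e' eE e'E.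
  by apply/negP => cr; have := in_set0 (e, e'); rewrite -nc inE /= eE e'E cr.
have := cr; rewrite inE /= => /and3P[eE e'E _].
have /(IH (E :\ e)) IHe : (#|E :\ e| < n)%N by move: En; rewrite (cardsD1 e) eE ltnS.
have {}IHe : (#|E :\ e| <= 4 * #|V| + #|crossings (E :\ e)|)%N.
  by apply: IHe => f /setD1P[_ /E_edge].
suff : (#|crossings (E :\ e)| < #|crossings E|)%N.
  have -> : #|E| = #|E :\ e|.+1 by rewrite (cardsD1 e) eE.
  by move=> cc; apply: leq_trans (_ : (4 * #|V| + #|crossings (E :\ e)|).+1 <= _)%N;
    rewrite ?ltnS // -addnS leq_add2l.
apply: proper_card; apply/properP; split.
  by apply/subsetP => x; rewrite !inE => /and3P[/andP[_ ->] /andP[_ ->] ->].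
by exists (e, e') => //; rewrite !inE eqxx.
Qed.

(** A point shared by the two edges would make the arcs equally high at [lo] or at [hi], or make the
    common range empty. With four distinct ends, a crossing survives the sampling with probability
    exactly [(q+1)^-4]. *)
Lemma crosses_endpoints V (e e' : C * (P * P)) : is_edge V e -> is_edge V e' ->
  crosses e e' -> uniq [:: e.2.1; e.2.2; e'.2.1; e'.2.2].
Proof.
move=> He He' /andP[]; set lo := Num.max _ _; set hi := Num.min _ _ => lohi cr.
have e_lt := edge_lt He; have e'_lt := edge_lt He'.
have nlo : h e.1 lo <> h e'.1 lo by case/orP: cr => /andP[]; lra.
have nhi : h e.1 hi <> h e'.1 hi by case/orP: cr => /andP[]; lra.
have lo_l : X e.2.1 <= lo by rewrite le_max lexx.
have lo_l' : X e'.2.1 <= lo by rewrite le_max lexx orbT.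
have hi_r : hi <= X e.2.2 by rewrite ge_min lexx.
have hi_r' : hi <= X e'.2.2 by rewrite ge_min lexx orbT.
rewrite /= !inE !negb_or !andbT -!andbA.
apply/and5P; split; last (apply/andP; split); apply/eqP => ee.
- by move: e_lt; rewrite ee ltxx.
- by apply: nlo; rewrite /lo ee maxxx -{1}ee (edge_l He) ee (edge_l He').
- by move: lo_l; rewrite ee; lra.
- by move: lo_l'; rewrite -ee; lra.
- by apply: nhi; rewrite /hi ee minxx -{1}ee (edge_r He) ee (edge_r He').
- by move: e'_lt; rewrite ee ltxx.
Qed.

(** Every vertex is kept with probability [1/(q+1)] and [card_edges_crossings] is averaged over all
    colourings. Kept edges remain edges for the smaller vertex set, since emptiness is inherited;
    vertices, edges and crossings survive with exponents 1, 2 and 4. *)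
Lemma crossing_sampling (V : {set P}) (E : {set C * (P * P)}) (q : nat) :
  (forall e, e \in E -> is_edge V e) ->
  (#|E| * q.+1 ^ 2 <= 4 * #|V| * q.+1 ^ 3 + #|crossings E|)%N.
Proof.
move=> E_edge.
pose Vf (f : {ffun P -> 'I_q.+1}) := [set z in V | f z == ord0].
pose kept (f : {ffun P -> 'I_q.+1}) (e : C * (P * P)) :=
  (f e.2.1 == ord0) && (f e.2.2 == ord0).
pose Ef f := [set e in E | kept f e].
have Ef_edge f e : e \in Ef f -> is_edge (Vf f) e.
  rewrite inE => /andP[/E_edge /and5P[on1 on2 V1 V2 /andP[lt12 /forall_inP emp]]].
  case/andP=> f1 f2; apply/and5P; split; rewrite ?inE ?V1 ?V2 //= lt12 /=.
  by apply/forall_inP => z; rewrite inE => /andP[/emp].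
pose N := (q.+1 ^ #|P|)%N.
have cnt (A : {set P}) (p : pred {ffun P -> 'I_q.+1}) j : #|A| = j ->
    (forall f, p f = [forall x in A, f x == ord0]) ->
    (#|[set f | p f]| * q.+1 ^ j = N)%N.
  move=> <- pA; rewrite /N -(card_vanishing q A); congr (_ * _)%N.
  by apply: eq_card => f; rewrite !inE pA.
have sumE : ((\sum_f #|Ef f|) * q.+1 ^ 2 = #|E| * N)%N.
  rewrite (sum_card_exchange E kept) big_distrl /= -sum_nat_const.
  apply: eq_bigr => e eE; apply: (cnt [set e.2.1; e.2.2]) => [|f].
    by rewrite cards2; have := edge_lt (E_edge _ eE); case: eqVneq => // ->; rewrite ltxx.
  apply/andP/forall_inP => [[f1 f2] x /set2P[]->//|fA].
  by split; apply: fA; rewrite !inE eqxx ?orbT.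
have sumV : ((\sum_f #|Vf f|) * q.+1 ^ 1 = #|V| * N)%N.
  rewrite (sum_card_exchange V (fun (f : {ffun P -> 'I_q.+1}) z => f z == ord0)).
  rewrite big_distrl /= -sum_nat_const.
  apply: eq_bigr => z zV; apply: (cnt [set z]) => [|f]; first by rewrite cards1.
  by apply/idP/forall_inP => [fz x /set1P->//|]; apply; rewrite inE.
have sumC : ((\sum_f #|crossings (Ef f)|) * q.+1 ^ 4 = #|crossings E| * N)%N.
  have -> : (\sum_f #|crossings (Ef f)| =
      \sum_f #|[set x in crossings E | kept f x.1 && kept f x.2]|)%N.
    apply: eq_bigr => f _; apply: eq_card => x; rewrite !inE.
    by move: (x.1 \in E) (x.2 \in E) (kept f x.1) (kept f x.2) (crosses x.1 x.2)
      => [] [] [] [] [].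
  rewrite (sum_card_exchange _ (fun f x => kept f x.1 && kept f x.2)).
  rewrite big_distrl /= -sum_nat_const.
  apply: eq_bigr => x; rewrite inE => /and3P[x1 x2 cr].
  have un := crosses_endpoints (E_edge _ x1) (E_edge _ x2) cr.
  apply: (cnt [set z in [:: x.1.2.1; x.1.2.2; x.2.2.1; x.2.2.2]]) => [|f].
    by rewrite cardsE (card_uniqP un).
  rewrite /kept -andbA; apply/and4P/forall_inP => [[f1 f2 f3 f4] z|fA].
    by rewrite !inE => /or4P[]/eqP->.
  by split; apply: fA; rewrite !inE eqxx ?orbT.
have key_le : (\sum_f #|Ef f| <= 4 * \sum_f #|Vf f| + \sum_f #|crossings (Ef f)|)%N.
  rewrite big_distrr -big_split /=; apply: leq_sum => f _.
  exact: card_edges_crossings (@Ef_edge f).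
have N0 : (0 < N)%N by rewrite expn_gt0.
rewrite -(leq_pmul2r N0) mulnDl -sumC mulnAC -sumE -mulnA -expnD.
rewrite (mulnAC (4 * #|V|)%N) -(mulnA 4 #|V|) -sumV (mulnA 4).
rewrite -(mulnA (4 * _)%N) -expnD -mulnDl.
by rewrite leq_mul2r key_le orbT.
Qed.

Lemma edge_same_arc V (e f : C * (P * P)) : is_edge V e -> is_edge V f ->
  e.1 = f.1 -> [\/ e = f, X e.2.2 <= X f.2.1 | X f.2.2 <= X e.2.1].
Proof.
move=> He Hf ef; have le := edge_lt He; have lf := edge_lt Hf.
have [l|l|l] := ltgtP (X e.2.1) (X f.2.1).
- apply: Or32; rewrite leNgt; apply/negP => l'.
  by apply: (edge_empty He (edge_inV Hf).1) => //; rewrite ef (edge_l Hf).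
- apply: Or33; rewrite leNgt; apply/negP => l'.
  by apply: (edge_empty Hf (edge_inV He).1) => //; rewrite -ef (edge_l He).
- apply: Or31; apply: (@edge_eq_l V [set e; f]);
    rewrite ?inE ?eqxx ?orbT ?ef //.
    by move=> g /set2P[]->.
  by apply: XY_inj => //; rewrite -(edge_l He) -(edge_l Hf) ef l.
Qed.

(** Two arcs cross at most once and edges of one arc do not overlap, so a crossing is determined by
    its pair of arcs. *)
Lemma card_crossings (V : {set P}) (B : {set C}) (E : {set C * (P * P)}) :
  (forall e, e \in E -> is_edge V e) -> (forall e, e \in E -> e.1 \in B) ->
  (#|crossings E| <= #|B| ^ 2)%N.
Proof.
move=> E_edge EB; rewrite -mulnn -cardsX.
apply: (@leq_card_rel _ _ _ _ (fun x c => c = (x.1.1, x.2.1))) => [x|].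
  rewrite inE => /and3P[x1 x2 _]; exists (x.1.1, x.2.1) => //.
  by rewrite inE /= !EB.
move=> [e f] [e' f'] c; rewrite !inE /= => /and3P[eE fE cr] /and3P[e'E f'E cr'].
move=> -> [ee ff].
wlog k : e f e' f' eE fE cr e'E f'E cr' ee ff / key e.1 <= key f.1.
  move=> W; have [k|/ltW k] := leP (key e.1) (key f.1); first exact: W.
  have crC g g' : crosses g g' -> crosses g' g.
    by rewrite /crosses maxC minC orbC.
  by have [-> ->] := W f e f' e' fE eE (crC _ _ cr) f'E e'E (crC _ _ cr') ff ee k.
have He := E_edge _ eE; have He' := E_edge _ e'E.
have Hf := E_edge _ fE; have Hf' := E_edge _ f'E.
have lt_incr a b : is_edge V a -> is_edge V b -> a.1 = e.1 -> b.1 = f.1 -> crosses a b ->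
    [/\ Num.max (X a.2.1) (X b.2.1) < Num.min (X a.2.2) (X b.2.2),
      h e.1 (Num.max (X a.2.1) (X b.2.1)) < h f.1 (Num.max (X a.2.1) (X b.2.1)) &
      h f.1 (Num.min (X a.2.2) (X b.2.2)) < h e.1 (Num.min (X a.2.2) (X b.2.2))].
  move=> Ha Hb ae bf; rewrite /crosses -ae -bf; set lo := Num.max _ _; set hi := Num.min _ _.
  case/andP=> lohi cc; split=> //; case/orP: cc => /andP[] //.
    have lo_l : X a.2.1 <= lo by rewrite le_max lexx.
    have lo_l' : X b.2.1 <= lo by rewrite le_max lexx orbT.
    have hi_r : hi <= X a.2.2 by rewrite ge_min lexx.
    have hi_r' : hi <= X b.2.2 by rewrite ge_min lexx orbT.
    have [d1 d2] := edge_dom2 Ha lo_l lohi hi_r.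
    have [d1' d2'] := edge_dom2 Hb lo_l' lohi hi_r'.
    move=> hlo hhi; move: k; rewrite -ae -bf le_eqVlt => /orP[/eqP k|k].
      have [ab|nab] := eqVneq a.1 b.1; first by move: hlo; rewrite ab ltxx.
      by have := h_key_eq d2 d1 d2' d1' k nab (ltW hhi); lra.
    by have := h_key_lt d1 d2 d1' d2' k lohi; lra.
  have lo_l : X a.2.1 <= lo by rewrite le_max lexx.
  have lo_l' : X b.2.1 <= lo by rewrite le_max lexx orbT.
  have hi_r : hi <= X a.2.2 by rewrite ge_min lexx.
  have hi_r' : hi <= X b.2.2 by rewrite ge_min lexx orbT.
  have [d1 d2] := edge_dom2 Ha lo_l lohi hi_r.
  have [d1' d2'] := edge_dom2 Hb lo_l' lohi hi_r'.
  move=> hlo hhi; move: k; rewrite -ae -bf le_eqVlt => /orP[/eqP k|k].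
    have [ab|nab] := eqVneq a.1 b.1; first by move: hlo; rewrite ab ltxx.
    by have := h_key_eq d2 d1 d2' d1' k nab (ltW hhi); lra.
  by have := h_key_lt d1 d2 d1' d2' k lohi; lra.
have [lohi hlo hhi] := lt_incr _ _ He Hf erefl erefl cr.
have [lohi' hlo' hhi'] := lt_incr _ _ He' Hf' (esym ee) (esym ff) cr'.
move: lohi hlo hhi lohi' hlo' hhi'.
set lo := Num.max _ _; set hi := Num.min _ _.
set lo' := Num.max _ _; set hi' := Num.min _ _ => lohi hlo hhi lohi' hlo' hhi'.
have lo_l : X e.2.1 <= lo by rewrite le_max lexx.
have lo_r : X f.2.1 <= lo by rewrite le_max lexx orbT.
have hi_l : hi <= X e.2.2 by rewrite ge_min lexx.
have hi_r : hi <= X f.2.2 by rewrite ge_min lexx orbT.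
have lo_l' : X e'.2.1 <= lo' by rewrite le_max lexx.
have lo_r' : X f'.2.1 <= lo' by rewrite le_max lexx orbT.
have hi_l' : hi' <= X e'.2.2 by rewrite ge_min lexx.
have hi_r' : hi' <= X f'.2.2 by rewrite ge_min lexx orbT.
have [d1 d2] := edge_dom2 He lo_l lohi hi_l.
have [d3 d4] := edge_dom2 Hf lo_r lohi hi_r.
have [d1' d2'] := edge_dom2 He' lo_l' lohi' hi_l'.
have [d3' d4'] := edge_dom2 Hf' lo_r' lohi' hi_r'.
rewrite -ee in d1' d2'; rewrite -ff in d3' d4'.
move: k; rewrite le_eqVlt => /orP[/eqP k|k].
  have [ab|nab] := eqVneq e.1 f.1; first by move: hlo; rewrite ab ltxx.
  by exfalso; have := h_key_eq d1 d2 d3 d4 k nab (ltW hlo); lra.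
(* With [key e.1 < key f.1] the difference of the arcs increases from negative to positive on each
   overlap. Two overlaps lying one after the other would force it to decrease in between. *)
have ovl : ~ (hi <= lo').
  rewrite le_eqVlt => /orP[/eqP E'|E']; first by move: hhi hlo'; rewrite E'; lra.
  by have := h_key_lt d2 d1' d4 d3' k E'; lra.
have ovr : ~ (hi' <= lo).
  rewrite le_eqVlt => /orP[/eqP E'|E']; first by move: hhi' hlo; rewrite E'; lra.
  by have := h_key_lt d2' d1 d4' d3 k E'; lra.
have eqe : e = e'.
  have [//|l|l] := edge_same_arc He He' ee.
    by case: ovl; apply: le_trans hi_l (le_trans l lo_l').
  by case: ovr; apply: le_trans hi_l' (le_trans l lo_l).
have eqf : f = f'.
  have [//|l|l] := edge_same_arc Hf Hf' ff.
    by case: ovl; apply: le_trans hi_r (le_trans l lo_r').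
  by case: ovr; apply: le_trans hi_r' (le_trans l lo_r).
by rewrite eqe eqf.
Qed.

(** Every incidence other than the last one on its arc is the left end of an edge, which bounds the
    incidences by the edges plus [#|B|]. *)
Lemma pseudo_arc_incidences (V : {set P}) (B : {set C}) (q : nat) :
  (#|[set x in setX B V | on_arc x.1 x.2]| * q.+1 ^ 2
   <= #|B| * q.+1 ^ 2 + 4 * #|V| * q.+1 ^ 3 + #|B| ^ 2)%N.
Proof.
set I := [set x in _ | _].
pose E := [set e : C * (P * P) | (e.1 \in B) && is_edge V e].
have E_edge e : e \in E -> is_edge V e by rewrite inE => /andP[].
have EB e : e \in E -> e.1 \in B by rewrite inE => /andP[].
have crE := crossing_sampling q E_edge; have crB := card_crossings E_edge EB.
suff IEB : (#|I| <= #|E| + #|B|)%N.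
  apply: leq_trans (leq_mul IEB (leqnn _)) _.
  rewrite mulnDl addnC -addnA leq_add2l.
  by apply: leq_trans crE _; rewrite leq_add2l.
pose J := [set x in I | [exists v in V, on_arc x.1 v && (X x.2 < X v)]].
rewrite -(cardsID J I); apply: leq_add.
  apply: (@leq_card_rel _ _ _ _ (fun x e => e.1 = x.1 /\ e.2.1 = x.2)); last first.
    by move=> [? ?] [? ?] e _ _ /= [-> ->] [-> ->].
  move=> x /setIP[_]; rewrite !inE => /andP[/andP[/andP[xB xV] xo]].
  case/exists_inP => v0 v0V /andP[o0 l0].
  have v0P : [pred v | [&& v \in V, on_arc x.1 v & X x.2 < X v]] v0.
    by rewrite /= v0V o0 l0.
  have [v /and3P[vV vo vl] vmin] := arg_minP X v0P.
  exists (x.1, (x.2, v)) => //; rewrite inE /= xB /is_edge /= xo vo xV vV vl /=.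
  apply/forall_inP => z zV; apply/negP => /and3P[zo z1 z2].
  by have := vmin z; rewrite /= zV zo z1 => /(_ isT); rewrite leNgt z2.
apply: (@leq_card_rel _ _ _ _ (fun x c => c = x.1)).
  by move=> x; rewrite !inE => /andP[_ /andP[/andP[xB _] _]]; exists x.1.
move=> [c u] [c' u'] d; rewrite !inE /=.
case/andP=> nJ /andP[/andP[cB uV] uo] /andP[nJ' /andP[/andP[cB' uV'] uo']] -> cc.
subst c'; rewrite cB uV uo /= in nJ; rewrite cB uV' uo' /= in nJ'.
congr pair; have [l|l|l] := ltgtP (X u) (X u').
- by case/negP: nJ; apply/exists_inP; exists u' => //; rewrite uo' l.
- by case/negP: nJ'; apply/exists_inP; exists u => //; rewrite uo l.
- apply: XY_inj => //.
  by case/andP: uo => _ /eqP->; case/andP: uo' => _ /eqP->; rewrite l.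
Qed.

End PseudoArcs.

(** * Exponents *)

Section Exponents.
Variable R : realFieldType.

(* The variables are logarithms: x, y, i, nu, u, v, l stand for two set sizes, a
   number of incidences, n, U, V and |L|; k and c absorb the constants. *)
Definition st_exp (k x y i : R) : Prop :=
  [\/ 2 * x <= y /\ i <= k + y, 2 * y <= x /\ i <= k + x | 3 * i <= k + 2 * x + 2 * y].

(** The logarithmic form of the invariant that links the number of partial chains to the size of
    their set of end points. *)
Definition weight_exp (c nu u v l : R) : Prop :=
  v <= c + nu \/ (v <= c + u /\ 3 * v + 2 * l <= c + 3 * u + nu).

(** [v + a - nu] is the logarithm of the weight after the first edge of a block, already divided by
    n. The conclusion is the weaker invariant that holds at this intermediate stage. The hypothesis
    [3 * u <= k + 4 * nu] expresses U = O(n^(4/3)); the factor 10 is slack. *)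
Lemma first_step_exp (k c nu u v l l1 a : R) :
  0 <= k -> 0 <= c -> nu <= u -> 3 * u <= k + 4 * nu -> 0 <= nu ->
  0 <= l -> l <= nu -> 0 <= l1 -> l1 <= nu ->
  weight_exp c nu u v l -> st_exp k l l1 (a + l1) -> a + l1 <= k + u ->
  let e := 10 * (k + c) in
  v + a - nu + l1 <= e + u /\
  (v + a - nu + l1 <= e + nu \/ 3 * (v + a - nu) + l1 <= e + 2 * nu).
Proof.
move=> k0 c0 h1 h2 h3 h4 h5 h6 h7 hw hs h8 e; rewrite /e; split.
  by case: hw => [hw|[hw hw']]; case: hs => [[? ?]|[? ?]|?]; lra.
have [hle|hlt] := lerP (v + a - nu + l1) (10 * (k + c) + nu); [by left|right].
by case: hw => [hw|[hw hw']]; case: hs => [[? ?]|[? ?]|?]; lra.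
Qed.

(** [m] is the logarithm of the growth of the number of chains over one block x, y, z, t. Its three
    bounds come from the product of the three degrees, from the two choices of y for given x and z,
    and from the two choices of z for given y and t. *)
Lemma weight_exp_step (k c nu u v l l1 l2 l3 a b g m : R) :
  0 <= k -> 0 <= c -> nu <= u -> 3 * u <= k + 4 * nu -> 0 <= nu ->
  0 <= l -> l <= nu -> 0 <= l1 -> l1 <= nu -> 0 <= l2 -> l2 <= nu ->
  0 <= l3 -> l3 <= nu ->
  weight_exp c nu u v l ->
  st_exp k l l1 (a + l1) -> st_exp k l1 l2 (b + l2) -> st_exp k l2 l3 (g + l3) ->
  a + l1 <= k + u ->
  m <= k + a + b + g -> m <= k + l + g -> m <= k + a + l1 ->
  weight_exp (100 * (k + c)) nu u (v + m - nu) l3.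
Proof.
move=> k0 c0 h1 h2 h3 h4 h5 h6 h7 h8 h9 h10 h11 hw s1 s2 s3 h12 m1 m2 m3.
have [A1 A2] := first_step_exp k0 c0 h1 h2 h3 h4 h5 h6 h7 hw s1 h12.
have vl : v + l <= 2 * nu + k + c by case: hw => [hw|[hw hw']]; lra.
move: A1 A2; set A := v + a - nu => A1 A2.
have M1 : v + m - nu <= k + A + b + g by rewrite /A; lra.
have M2 : v + m - nu <= 2 * k + c + nu + g by lra.
have M3 : v + m - nu <= k + A + l1 by rewrite /A; lra.
(* Only the three bounds on the new weight and the intermediate invariant matter from here on;
   abstracting them leaves a linear program in few variables. *)
move: (v + m - nu) M1 M2 M3 => w M1 M2 M3.
clear hw s1 vl m1 m2 m3 h12; clearbody A.
have [hle|hlt] := lerP w (100 * (k + c) + nu); [by left|right].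
split; first by lra.
case: A2 => A2; first by lra.
by case: s3 => [[? ?]|[? ?]|s3]; [lra|lra|]; case: s2 => [[? ?]|[? ?]|s2]; lra.
Qed.
End Exponents.

(** * Counting walks in dyadic classes *)

Section Walks.
Local Open Scope nat_scope.
Variable T : finType.
Implicit Types (e : rel T) (A B D L : {set T}) (f : T -> nat).

(* Walks along the relations of es in which, inside each consecutive block of
   three relations, no vertex equals the vertex two steps earlier. *)
Fixpoint walks (es : seq (rel T)) (x : T) : nat :=
  match es with
  | [::] => 1
  | [:: e1] => \sum_(y | e1 x y) 1
  | [:: e1; e2] => \sum_(y | e1 x y) \sum_(z | e2 y z && (x != z)) 1
  | e1 :: e2 :: e3 :: es' =>
      \sum_(y | e1 x y) \sum_(z | e2 y z && (x != z))
        \sum_(t | e3 z t && (y != t)) walks es' t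
  end.

Definition degree e A (y : T) := #|[set x in A | e x y]|.

(** Degree zero is excluded explicitly because [trunc_log 2 0] is [0], which would put isolated
    vertices into class [0]. *)
Definition dyadic_class e A (a : nat) :=
  [set y | (0 < degree e A y) && (trunc_log 2 (degree e A y) == a)].

Definition inc e A B := #|[set x in setX A B | e x.1 x.2]|.

(** For distance relations this is the fact that two circles with different centres meet in at most
    two points. *)
Definition two_steps e e' :=
  forall x z, x != z -> #|[set y | e x y && e' y z]| <= 2.

Definition ndyadic := (trunc_log 2 #|T|).+1.

Lemma sum_degree e A B f :
  \sum_(x in A) \sum_(y in B | e x y) f y = \sum_(y in B) degree e A y * f y.
Proof.
rewrite (exchange_big_dep (fun y => y \in B)) /=; last by move=> x y _ /andP[].
apply: eq_bigr => y yB; rewrite yB /degree -sum1_card big_distrl /=.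
by apply: eq_big => [x|x _]; rewrite ?inE ?mul1n.
Qed.

Lemma incE e A B : inc e A B = \sum_(y in B) degree e A y.
Proof.
transitivity (\sum_(x in A) \sum_(y in B | e x y) 1); last first.
  by rewrite sum_degree; apply: eq_bigr => y _; rewrite muln1.
rewrite /inc -sum1_card pair_big_dep /=; apply: eq_bigl => -[x y].
by rewrite !inE /= andbA.
Qed.

Lemma sum_dyadic_class e A a f :
  \sum_(x in A) \sum_(y in dyadic_class e A a | e x y) f y
  <= 2 ^ a.+1 * \sum_(y in dyadic_class e A a) f y.
Proof.
rewrite sum_degree big_distrr /=; apply: leq_sum => y; rewrite inE => /andP[d0 /eqP<-].
by rewrite leq_mul2r ltnW ?orbT // (proj2 (andP (trunc_log_bounds _ d0))).
Qed.

Lemma card_dyadic_class e A a :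
  2 ^ a * #|dyadic_class e A a| <= inc e A (dyadic_class e A a).
Proof.
rewrite incE mulnC -sum_nat_const; apply: leq_sum => y; rewrite inE => /andP[d0 /eqP<-].
by case/andP: (trunc_log_bounds (isT : 1 < 2) d0).
Qed.

Lemma dyadic_split e A (P : pred T) f x : x \in A ->
  \sum_(y | e x y && P y) f y
  = \sum_(a < ndyadic) \sum_(y in dyadic_class e A a | e x y && P y) f y.
Proof.
move=> xA.
have lt y : trunc_log 2 (degree e A y) < ndyadic.
  by rewrite ltnS leq_trunc_log // /degree max_card.
rewrite (partition_big (fun y => Ordinal (lt y)) predT) //=.
apply: eq_bigr => a _; apply: eq_bigl => y; rewrite inE.
rewrite andbC; case exy: (e x y) => //=; rewrite ?andbF //.
suff -> : 0 < degree e A y by [].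
by rewrite card_gt0; apply/set0Pn; exists x; rewrite inE xA.
Qed.

(** Summing over [z] before [y], each pair of distinct [x] and [z] has at most two common neighbours
    [y]. *)
Lemma sum_two_steps e e' A B D f : two_steps e e' ->
  \sum_(x in A) \sum_(y in B | e x y) \sum_(z in D | e' y z && (x != z)) f z
  <= 2 * #|A| * \sum_(z in D) f z.
Proof.
move=> ts; rewrite -mulnA mulnCA -sum_nat_const; apply: leq_sum => x _.
rewrite (exchange_big_dep (fun z => z \in D)) /=; last by move=> y z _ /andP[].
rewrite big_distrr /=; apply: leq_sum => z zD.
have [->|nxz] := eqVneq x z; first by rewrite big_pred0 // => y; rewrite zD /= !andbF.
rewrite sum_nat_const leq_mul2r; apply/orP; right.
apply: leq_trans (ts _ _ nxz); apply/subset_leq_card/subsetP => y.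
by rewrite !inE => /andP[/andP[_ ->] /andP[_ /andP[->]]].
Qed.

Section Block.
Variables (e1 e2 e3 : rel T) (A : {set T}) (a b g : nat) (f : T -> nat).
Let A1 := dyadic_class e1 A a.
Let A2 := dyadic_class e2 A1 b.
Let A3 := dyadic_class e3 A2 g.

(** The classes are nested: degrees of z are taken into the class [A1] of y, and those of t into the
    class [A2] of z, so every class size obeys an incidence bound with the preceding class. *)
Definition block_sum :=
  \sum_(x in A) \sum_(y in A1 | e1 x y)
    \sum_(z in A2 | e2 y z && (x != z)) \sum_(t in A3 | e3 z t && (y != t)) f t.

Lemma block_le_degrees :
  block_sum <= 2 ^ a.+1 * 2 ^ b.+1 * 2 ^ g.+1 * \sum_(t in A3) f t.
Proof.
apply: (@leq_trans (\sum_(x in A) \sum_(y in A1 | e1 x y)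
    \sum_(z in A2 | e2 y z) \sum_(t in A3 | e3 z t) f t)).
  apply: leq_sum => x _; apply: leq_sum => y _.
  apply: (@leq_trans (\sum_(z in A2 | e2 y z) \sum_(t in A3 | e3 z t && (y != t)) f t)).
    by apply: sub_le_big => //= [? ?|z /andP[-> /andP[->]]]; rewrite ?leq_addr.
  apply: leq_sum => z _.
  by apply: sub_le_big => //= [? ?|t /andP[-> /andP[->]]]; rewrite ?leq_addr.
apply: leq_trans (sum_dyadic_class _ _ _ _) _; rewrite -!mulnA leq_mul2l; apply/orP; right.
apply: leq_trans (sum_dyadic_class _ _ _ _) _; rewrite leq_mul2l; apply/orP; right.
exact: sum_dyadic_class.
Qed.

Lemma block_le_start : two_steps e1 e2 ->
  block_sum <= 2 * #|A| * 2 ^ g.+1 * \sum_(t in A3) f t.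
Proof.
move=> ts; apply: (@leq_trans (\sum_(x in A) \sum_(y in A1 | e1 x y)
    \sum_(z in A2 | e2 y z && (x != z)) \sum_(t in A3 | e3 z t) f t)).
  apply: leq_sum => x _; apply: leq_sum => y _; apply: leq_sum => z _.
  by apply: sub_le_big => //= [? ?|t /andP[-> /andP[->]]]; rewrite ?leq_addr.
apply: leq_trans (sum_two_steps _ _ _ _ ts) _; rewrite -!mulnA !leq_mul2l; apply/orP; right.
by apply/orP; right; exact: sum_dyadic_class.
Qed.

(** The sum over x costs the degree of y; for given y and t there remain two choices of z. *)
Lemma block_le_middle : two_steps e2 e3 ->
  block_sum <= 2 ^ a.+1 * (2 * #|A1|) * \sum_(t in A3) f t.
Proof.
move=> ts; apply: (@leq_trans (\sum_(x in A) \sum_(y in A1 | e1 x y)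
    \sum_(z in A2 | e2 y z) \sum_(t in A3 | e3 z t && (y != t)) f t)).
  apply: leq_sum => x _; apply: leq_sum => y _.
  by apply: sub_le_big => //= [? ?|z /andP[-> /andP[->]]]; rewrite ?leq_addr.
apply: leq_trans (sum_dyadic_class _ _ _ _) _; rewrite -!mulnA leq_mul2l; apply/orP; right.
by rewrite mulnA; exact: sum_two_steps.
Qed.
End Block.

Lemma walks_split e1 e2 e3 es A :
  \sum_(x in A) walks [:: e1, e2, e3 & es] x =
  \sum_(a < ndyadic) \sum_(b < ndyadic) \sum_(g < ndyadic)
    block_sum e1 e2 e3 A a b g (walks es).
Proof.
rewrite /block_sum /=.
transitivity (\sum_(x in A) \sum_(a < ndyadic) \sum_(b < ndyadic) \sum_(g < ndyadic)
  \sum_(y in dyadic_class e1 A a | e1 x y)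
    \sum_(z in dyadic_class e2 (dyadic_class e1 A a) b | e2 y z && (x != z))
      \sum_(t in dyadic_class e3 (dyadic_class e2 (dyadic_class e1 A a) b) g
             | e3 z t && (y != t)) walks es t).
  apply: eq_bigr => x xA.
  under eq_bigl do rewrite -[e1 _ _]andbT.
  rewrite (dyadic_split e1 predT _ xA); apply: eq_bigr => a _.
  under [RHS]eq_bigr do rewrite exchange_big /=.
  rewrite [RHS]exchange_big /=.
  apply: eq_big => [y|y /andP[yA _]]; first by rewrite andbT.
  rewrite (dyadic_split e2 (fun z => x != z) _ yA); apply: eq_bigr => b _.
  rewrite [RHS]exchange_big /=; apply: eq_bigr => z /andP[zA _].
  by rewrite (dyadic_split e3 (fun t => y != t) _ zA).
rewrite exchange_big /=; apply: eq_bigr => a _.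
rewrite exchange_big /=; apply: eq_bigr => b _.
by rewrite exchange_big.
Qed.

End Walks.

From mathcomp Require Import all_classical all_reals all_analysis.
Import Order.TTheory GRing.Theory Num.Theory.
Import numFieldNormedType.Exports.
Local Open Scope ring_scope.

(** * Incidences of circles *)

Section Circles.
Variable R : realType.
Implicit Types (d : R).

Lemma dist2_sqr (p q : R * R) d : 0 <= d ->
  dist2 p q = d <-> (p.1 - q.1) ^+ 2 + (p.2 - q.2) ^+ 2 = d ^+ 2.
Proof.
move=> d0; rewrite /dist2; split => [<-|->].
  by rewrite sqr_sqrtr // addr_ge0 ?sqr_ge0.
by rewrite sqrtr_sqr ger0_norm.
Qed.

Lemma dist2C (p q : R * R) : dist2 p q = dist2 q p.
Proof. by rewrite /dist2; congr Num.sqrt; ring. Qed.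

Lemma norm_le_sqr (b d : R) : 0 <= d -> (`|b| <= d) = (b ^+ 2 <= d ^+ 2).
Proof. by move=> d0; rewrite -[b ^+ 2]real_normK ?num_real // ler_pXn2r ?nnegrE. Qed.

(** Strict concavity of a half-circle. After squaring it reduces to [A * W + a * w < d ^+ 2], the
    strict Cauchy-Schwarz inequality for two distinct points of the circle. *)
Lemma sqrt_circle_concave d a w (l : R) : 0 <= d -> a < w -> 0 < l < 1 ->
  `|a| <= d -> `|w| <= d ->
  l * Num.sqrt (d ^+ 2 - a ^+ 2) + (1 - l) * Num.sqrt (d ^+ 2 - w ^+ 2) <
  Num.sqrt (d ^+ 2 - (l * a + (1 - l) * w) ^+ 2).
Proof.
move=> d0 aw /andP[l0 l1] ad wd.
have sq_le (b : R) : `|b| <= d -> 0 <= d ^+ 2 - b ^+ 2.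
  by rewrite norm_le_sqr // subr_ge0.
set A := Num.sqrt (d ^+ 2 - a ^+ 2); set W := Num.sqrt (d ^+ 2 - w ^+ 2).
have A2 : A ^+ 2 = d ^+ 2 - a ^+ 2 by rewrite sqr_sqrtr ?sq_le.
have W2 : W ^+ 2 = d ^+ 2 - w ^+ 2 by rewrite sqr_sqrtr ?sq_le.
have r0 : 0 <= l * A + (1 - l) * W.
  by rewrite addr_ge0 ?mulr_ge0 ?sqrtr_ge0 // ?subr_ge0 ltW.
have key : A * W + a * w < d ^+ 2.
  have : 0 < (a - w) ^+ 2 by rewrite exprn_even_gt0 //= subr_eq0 lt_eqF.
  have : 0 <= (A - W) ^+ 2 by exact: sqr_ge0.
  by nra.
have lt2 : (l * A + (1 - l) * W) ^+ 2 < d ^+ 2 - (l * a + (1 - l) * w) ^+ 2.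
  have ll : 0 < l * (1 - l) by rewrite mulr_gt0 // subr_gt0.
  have := ltr_pM2l ll (A * W + a * w) (d ^+ 2); rewrite key => kk.
  by nra.
rewrite -(ger0_norm r0) -sqrtr_sqr ltr_sqrt //.
by apply: le_lt_trans lt2; exact: sqr_ge0.
Qed.

(** The inner points [u] and [v] are complementary convex combinations of [a] and [w]; adding the
    two concavity inequalities gives the claim, which is the monotonicity [h_key_lt] for
    half-circles. *)
Lemma sqrt_circle_swap d a u v w : 0 <= d -> a < u -> u < w -> u + v = a + w ->
  `|a| <= d -> `|w| <= d ->
  Num.sqrt (d ^+ 2 - a ^+ 2) + Num.sqrt (d ^+ 2 - w ^+ 2) <
  Num.sqrt (d ^+ 2 - u ^+ 2) + Num.sqrt (d ^+ 2 - v ^+ 2).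
Proof.
move=> d0 au uw uv ad wd; have aw := lt_trans au uw.
have wa0 : w - a != 0 by rewrite subr_eq0 gt_eqF.
pose l := (w - u) / (w - a).
have lE : l * (w - a) = w - u by rewrite /l divfK.
have l0 : 0 < l by rewrite divr_gt0 ?subr_gt0.
have l1 : l < 1 by rewrite ltr_pdivrMr ?subr_gt0 // mul1r ler_ltD // ltrN2.
have h1 := sqrt_circle_concave d0 aw (introT andP (conj l0 l1)) ad wd.
have l' : 0 < 1 - l < 1 by apply/andP; split; lra.
have h2 := sqrt_circle_concave d0 aw l' ad wd.
have e1 : l * a + (1 - l) * w = u by lra.
have e2 : (1 - l) * a + (1 - (1 - l)) * w = v by lra.
by rewrite e1 in h1; rewrite e2 in h2; lra.
Qed.

Section Incidences.
Variables (T : finType) (pt : T -> R * R) (d : R).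
Hypothesis pt_inj : injective pt.
Hypothesis d_gt0 : 0 < d.

Definition lower_arc (c : T) (x : R) : R :=
  (pt c).2 - Num.sqrt (d ^+ 2 - (x - (pt c).1) ^+ 2).

Definition lower_inc (c u : T) := (dist2 (pt c) (pt u) == d) && ((pt u).2 <= (pt c).2).

Lemma lower_incidences (B V : {set T}) (q : nat) :
  (#|[set x in finset.setX B V | lower_inc x.1 x.2]| * q.+1 ^ 2
   <= #|B| * q.+1 ^ 2 + 4 * #|V| * q.+1 ^ 3 + #|B| ^ 2)%N.
Proof.
pose X u := (pt u).1; pose Y u := (pt u).2.
pose dom c (x : R) := `|x - (pt c).1| <= d.
apply: leq_trans (@pseudo_arc_incidences _ _ _ X Y lower_arc dom X _ _ _ _ V B q).
- rewrite leq_mul2r; apply/orP; right; apply/subset_leq_card/fintype.subsetP => -[c u].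
  rewrite !inE /lower_inc /= => /andP[->] /= /andP[/eqP/(dist2_sqr _ _ (ltW d_gt0)) e uc].
  have e1 : d ^+ 2 - (X u - (pt c).1) ^+ 2 = ((pt c).2 - (pt u).2) ^+ 2.
    by rewrite -e /X; ring.
  rewrite /on_arc; apply/andP; split.
    by rewrite /dom (norm_le_sqr _ (ltW d_gt0)) -subr_ge0 e1 sqr_ge0.
  rewrite /lower_arc e1 sqrtr_sqr ger0_norm ?subr_ge0 //.
  by apply/eqP; rewrite /Y; ring.
- by move=> u v xx yy; apply: pt_inj;
    rewrite [pt u]surjective_pairing -/(X u) -/(Y u) xx yy -surjective_pairing.
- by move=> c x y z; rewrite /dom !ler_norml; lra.
- move=> c c' x y d1 d2 d3 d4; rewrite /X /lower_arc => k xy.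
  have := @sqrt_circle_swap d (x - (pt c').1) (x - (pt c).1) (y - (pt c').1) (y - (pt c).1).
  rewrite (ltW d_gt0) => /(_ isT); rewrite ltrD2l ltrN2 ltrD2r => /(_ k xy) hh.
  by have := hh _ d3 d2; lra.
- move=> c c' x y _ _ _ _; rewrite /X /lower_arc => k nc.
  rewrite k; set s := Num.sqrt _; set t := Num.sqrt _ => hle.
  suff : (pt c).2 != (pt c').2 by lra.
  apply: contra nc => /eqP e; apply/eqP/pt_inj.
  by rewrite [pt c]surjective_pairing k e -surjective_pairing.
Qed.

End Incidences.

Definition incidences (T : finType) (pt : T -> R * R) (d : R) (B V : {set T}) :=
  #|[set x in finset.setX B V | dist2 (pt x.1) (pt x.2) == d]|.

Lemma incidencesC (T : finType) (pt : T -> R * R) d (B V : {set T}) :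
  incidences pt d B V = incidences pt d V B.
Proof.
have swapK (U : finType) : cancel (fun x : U * U => (x.2, x.1)) (fun x => (x.2, x.1)) by case.
rewrite /incidences -(card_imset _ (can_inj (swapK T))); apply: eq_card => -[u v].
apply/imsetP/idP => [[[c w]]|].
  by rewrite !inE /= => /andP[/andP[cB wV] e] [-> ->]; rewrite wV cB dist2C.
by rewrite !inE /= => /andP[/andP[cB wV] e]; exists (v, u) => //; rewrite !inE /= wV cB dist2C.
Qed.

(** The reflection of the plane in the origin turns upper half-circles into lower ones, so two
    applications of the half-circle bound cover all incidences. *)
Lemma circle_incidences (T : finType) (pt : T -> R * R) d (B V : {set T}) (q : nat) :
  injective pt -> 0 < d ->
  (incidences pt d B V * q.+1 ^ 2
   <= 2 * (#|B| * q.+1 ^ 2 + 4 * #|V| * q.+1 ^ 3 + #|B| ^ 2))%N.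
Proof.
move=> pt_inj d0; rewrite mul2n -addnn.
pose npt u := (- (pt u).1, - (pt u).2).
have npt_inj : injective npt.
  move=> u v [/oppr_inj e1 /oppr_inj e2]; apply: pt_inj.
  by rewrite [LHS]surjective_pairing e1 e2 -surjective_pairing.
apply: leq_trans (leq_add (lower_incidences pt_inj d0 B V q) (lower_incidences npt_inj d0 B V q)).
rewrite -mulnDl leq_mul2r; apply/orP; right.
apply: leq_trans (leq_card_setU _ _); apply/subset_leq_card/fintype.subsetP => -[c u].
rewrite !inE /lower_inc /= => /andP[-> /= e].
have e' : dist2 (npt c) (npt u) == d.
  by rewrite -(eqP e); apply/eqP; rewrite /dist2 /npt /=; congr Num.sqrt; ring.
by rewrite e e' /= lerN2; exact: le_total.
Qed.

(** The Szemeredi-Trotter bound without fractional powers: the two degenerate ranges, in which one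
    side dominates, and the cubed main term. *)
Definition st_bound (K I b v : nat) : Prop :=
  [\/ (b ^ 2 <= v)%N /\ (I <= K * v)%N, (v ^ 2 <= b)%N /\ (I <= K * b)%N |
      (I ^ 3 <= K ^ 3 * (b ^ 2 * v ^ 2))%N].

Lemma szemeredi_trotter (T : finType) (pt : T -> R * R) d (B V : {set T}) :
  injective pt -> 0 < d -> st_bound 24 (incidences pt d B V) #|B| #|V|.
Proof.
move=> pt_inj d0.
have inc (A W : {set T}) (q : nat) := circle_incidences A W q pt_inj d0.
have inc1 (A W : {set T}) : (#|A| ^ 2 <= #|W|)%N -> (incidences pt d A W <= 24 * #|W|)%N.
  move=> le; have := inc A W 0; rewrite !exp1n !muln1.
  have := leq_pexp2l; case: #|A| le => [|a] le; first by lia.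
  by move=> _; nia.
have [le|lt] := leqP (#|B| ^ 2) #|V|; first by apply: Or31; split=> //; exact: inc1.
have [le|lt'] := leqP (#|V| ^ 2) #|B|.
  by apply: Or32; split=> //; rewrite incidencesC; exact: inc1.
apply: Or33; move: (incidences _ _ _ _) (inc B V) => I {}inc.
move: #|B| #|V| lt lt' inc => b v lt lt' inc.
have v0 : (0 < v)%N by case: v lt' {lt inc}.
(* The sampling rate balances the two main terms: the least q with b^2 <= v q^3 is about
   (b^2/v)^(1/3). It is at least 2 outside the degenerate ranges. *)
have ex : exists q, (b ^ 2 <= v * q ^ 3)%N.
  exists (b ^ 2)%N; rewrite -[X in (X <= _)%N]mul1n leq_mul // -[X in (X <= _)%N]expn1.
  by rewrite leq_pexp2l // (leq_ltn_trans _ lt).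
case: (ex_minnP ex) => -[|[|q]] hq qmin.
- by move: hq; rewrite exp0n // muln0 => hq; move: lt; lia.
- by move: hq; rewrite exp1n muln1 => hq; move: lt; lia.
have hq' : (v * q.+1 ^ 3 < b ^ 2)%N.
  by rewrite ltnNge; apply/negP => /qmin; rewrite ltnn.
have Q0 : (0 < q.+2 ^ 2)%N by [].
have IQ : (I <= 2 * b + 10 * (v * q.+2))%N.
  rewrite -(leq_pmul2r Q0); apply: leq_trans (inc q.+1) _.
  apply: leq_trans (leq_mul (leqnn 2) (leq_add (leqnn _) hq)) _.
  by rewrite (expnS q.+2 2); lia.
have vq3 : ((v * q.+2) ^ 3 <= 8 * (b ^ 2 * v ^ 2))%N.
  apply: leq_trans (_ : (2 * (v * q.+1)) ^ 3 <= _)%N.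
    by rewrite leq_exp2r //; lia.
  rewrite !expnMn (_ : 2 ^ 3 = 8)%N // leq_mul2l /= (expnSr v 2) -mulnA mulnC leq_mul2r.
  by rewrite ltnW ?orbT.
have b3 : (b ^ 3 <= b ^ 2 * v ^ 2)%N by rewrite expnSr leq_mul2l ltnW ?orbT.
have le_max : (I <= 12 * maxn b (v * q.+2))%N.
  by apply: leq_trans IQ _; have := leq_maxl b (v * q.+2); have := leq_maxr b (v * q.+2); lia.
apply: leq_trans (_ : (12 * maxn b (v * q.+2)) ^ 3 <= _)%N; first by rewrite leq_exp2r.
rewrite (_ : 24 = 12 * 2)%N // !expnMn -!mulnA leq_mul2l; apply/orP; right.
by rewrite /maxn; case: ifP => _; [move: vq3|move: b3]; set z := (b ^ 2 * v ^ 2)%N; lia.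
Qed.

(** Relative to the vector [w] joining the centres, the two distances determine the inner product
    [dt] of a common point and the square of its cross product [cr]. Only the sign of [cr] is free,
    so three distinct points are impossible. *)
Lemma card_circle_inter (T : finType) (pt : T -> R * R) (d1 d2 : R) (a b : T) :
  injective pt -> 0 <= d1 -> 0 <= d2 -> a != b ->
  (#|[set y | (dist2 (pt a) (pt y) == d1) && (dist2 (pt y) (pt b) == d2)]| <= 2)%N.
Proof.
move=> pt_inj d10 d20 nab; rewrite leqNgt; apply/negP => /card_gt2P.
move=> [y1 [y2 [y3 [[Y1 Y2 Y3] [n12 n23 n31]]]]].
pose w := ((pt b).1 - (pt a).1, (pt b).2 - (pt a).2).
pose u y := ((pt y).1 - (pt a).1, (pt y).2 - (pt a).2).
pose cr y := w.1 * (u y).2 - w.2 * (u y).1.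
pose dt y := w.1 * (u y).1 + w.2 * (u y).2.
pose k := (d1 ^+ 2 + w.1 ^+ 2 + w.2 ^+ 2 - d2 ^+ 2) / 2.
have w0 : 0 < w.1 ^+ 2 + w.2 ^+ 2.
  rewrite lt_neqAle addr_ge0 ?sqr_ge0 // andbT; apply: contra nab => /eqP/esym/eqP.
  rewrite paddr_eq0 ?sqr_ge0 // !sqrf_eq0 /= !subr_eq0 => /andP[/eqP e1 /eqP e2].
  by apply/eqP/pt_inj; rewrite [LHS]surjective_pairing -e1 -e2 -surjective_pairing.
have mem y : y \in [set y | (dist2 (pt a) (pt y) == d1) && (dist2 (pt y) (pt b) == d2)] ->
    dt y = k /\ cr y ^+ 2 = (w.1 ^+ 2 + w.2 ^+ 2) * d1 ^+ 2 - k ^+ 2.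
  rewrite inE => /andP[/eqP/(dist2_sqr _ _ d10) e1 /eqP/(dist2_sqr _ _ d20) e2].
  have dk : dt y = k by rewrite /k -e1 -e2 /dt /w /u /=; field.
  split=> //; rewrite -dk -e1 /cr /dt /u /w /=; ring.
have same y y' : dt y = dt y' -> cr y = cr y' -> y = y'.
  move=> e1 e2; apply: pt_inj.
  have n0 : w.1 ^+ 2 + w.2 ^+ 2 != 0 by rewrite gt_eqF.
  have f1 : (u y).1 = (u y').1.
    apply: (mulfI n0); transitivity (w.1 * dt y - w.2 * cr y); first by rewrite /dt /cr; ring.
    by rewrite e1 e2 /dt /cr; ring.
  have f2 : (u y).2 = (u y').2.
    apply: (mulfI n0); transitivity (w.2 * dt y + w.1 * cr y); first by rewrite /dt /cr; ring.
    by rewrite e1 e2 /dt /cr; ring.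
  move: f1 f2; rewrite /u /= => /addIr f1 /addIr f2.
  by rewrite [LHS]surjective_pairing f1 f2 -surjective_pairing.
have [D1 C1] := mem _ Y1; have [D2 C2] := mem _ Y2; have [D3 C3] := mem _ Y3.
have opp y y' : dt y = k -> dt y' = k -> cr y ^+ 2 = cr y' ^+ 2 -> y != y' -> cr y = - cr y'.
  move=> e e' /eqP; rewrite eqf_sqr => /orP[/eqP c|/eqP//] /eqP[].
  by apply: same; rewrite ?e.
have o1 := opp _ _ D1 D2 (etrans C1 (esym C2)) n12.
have o2 := opp _ _ D2 D3 (etrans C2 (esym C3)) n23.
by move/eqP: n31; apply; apply: same; rewrite ?D3 // o1 o2 opprK.
Qed.

End Circles.

(** * The upper bound *)

Section WalkBound.
Variable R : realType.

Lemma le_expR_mul (x y s : R) : 0 < x -> 0 < y -> ln x <= s + ln y -> x <= expR s * y.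
Proof.
move=> x0 y0 h; rewrite -[x]lnK // -[y]lnK // -expRD ler_expR //.
Qed.

Lemma st_bound_ln (i I b v : nat) : (0 < i)%N -> (i <= I)%N -> (0 < b)%N -> (0 < v)%N ->
  st_bound 24 I b v -> st_exp (3 * ln (24 : R)) (ln b%:R) (ln v%:R) (ln i%:R).
Proof.
move=> i0 iI b0 v0.
have pos (m : nat) : (0 < m)%N -> (m%:R : R) \is Num.pos by move=> m0; rewrite posrE ltr0n.
have lnle (m p : nat) : (0 < m)%N -> (m <= p)%N -> ln (m%:R : R) <= ln p%:R.
  by move=> m0 mp; rewrite ler_ln ?pos ?ler_nat // (leq_trans m0).
have lnX (m j : nat) : (0 < m)%N -> ln ((m ^ j)%:R : R) = j%:R * ln m%:R.
  by move=> m0; rewrite natrX lnXn ?ltr0n // mulr_natl.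
have lnMn (m p : nat) : (0 < m)%N -> (0 < p)%N -> ln ((m * p)%:R : R) = ln m%:R + ln p%:R.
  by move=> m0 p0; rewrite natrM lnM ?pos.
have l24 : 0 <= ln (24 : R) by rewrite ln_ge0 // ler1n.
case=> [[h1 h2]|[h1 h2]|h].
- have := lnle _ _ _ h1; rewrite expn_gt0 b0 => /(_ isT); rewrite lnX // => h1'.
  have := lnle _ _ i0 (leq_trans iI h2); rewrite lnMn // => h2'.
  by apply: Or31; split=> //; lra.
- have := lnle _ _ _ h1; rewrite expn_gt0 v0 => /(_ isT); rewrite lnX // => h1'.
  have := lnle _ _ i0 (leq_trans iI h2); rewrite lnMn // => h2'.
  by apply: Or32; split=> //; lra.
- have h3 : (i ^ 3 <= 24 ^ 3 * (b ^ 2 * v ^ 2))%N by apply: leq_trans h; rewrite leq_exp2r.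
  have := lnle _ _ _ h3; rewrite expn_gt0 i0 => /(_ isT).
  rewrite (lnX i) // (lnMn (24 ^ 3)%N) ?muln_gt0 ?expn_gt0 ?b0 ?v0 //.
  rewrite (lnMn (b ^ 2)%N) ?expn_gt0 ?b0 ?v0 // (lnX 24%N) // (lnX b) // (lnX v) // => h4.
  by apply: Or33; lra.
Qed.

(** The order of magnitude of the number of walks with [m] edges: three base cases, and a factor n
    for each block of three edges. *)
Fixpoint walk_target (m : nat) (n U : R) : R :=
  match m with
  | 0 => n
  | 1 => U
  | 2 => n ^+ 2
  | m'.+3 => n * walk_target m' n U
  end.

Lemma walk_target_ge0 m n U : 0 <= n -> 0 <= U -> 0 <= walk_target m n U.
Proof.
move=> n0 U0; elim/ltn_ind: m => -[|[|[|m]]] IH //=; first exact: exprn_ge0.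
by apply: mulr_ge0 => //; apply: IH; lia.
Qed.

Definition good_relation (T : finType) (U : R) (e : rel T) :=
  forall A B, st_bound 24 (inc e A B) #|A| #|B| /\ (inc e A B)%:R <= U.

(** Induction by blocks of three edges. The invariant constant [c] grows to [100 * (k + c)] in each
    block and is therefore generalised; [C] depends only on [m], [K] and [c], not on the point set.
    The zero, one or two edges left at the end are bounded directly from the invariant. *)
Lemma walks_bound (m : nat) (K c : R) : 1 <= K -> 0 <= c ->
  exists2 C : R, 0 < C &
  forall (T : finType) (I : eqType) (rl : I -> rel T) (ds : seq I) (U V : R) (A : {set T}),
    size ds = m -> #|T|%:R <= U -> U ^+ 3 <= K * #|T|%:R ^+ 4 ->
    {in ds, forall d, good_relation U (rl d)} ->
    {in ds &, forall d d', two_steps (rl d) (rl d')} ->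
    0 < V -> (0 < #|A|)%N ->
    weight_exp c (ln #|T|%:R) (ln U) (ln V) (ln #|A|%:R) ->
    V * (\sum_(x in A) walks (map rl ds) x)%:R
    <= C * (ndyadic T)%:R ^+ m * (#|T|%:R * walk_target m #|T|%:R U).
Proof.
(* [k] absorbs [K], the Szemeredi-Trotter constant and the factor 8 lost by rounding three degrees
   to powers of two. *)
move=> K1; pose k : R := ln K + 3 * ln 24 + ln 8.
have lK : 0 <= ln K by exact: ln_ge0.
have l24 : 0 <= ln (24 : R) by rewrite ln_ge0 // ler1n.
have l8 : 0 <= ln (8 : R) by rewrite ln_ge0 // ler1n.
have k0 : 0 <= k by rewrite /k; lra.
have basics (T : finType) (U : R) (A : {set T}) : (0 < #|A|)%N ->
    #|T|%:R <= U -> U ^+ 3 <= K * #|T|%:R ^+ 4 ->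
    let nu := ln (#|T|%:R : R) in
    [/\ (0 < #|T|)%N, 0 < U, nu <= ln U & 3 * ln U <= k + 4 * nu] /\
    [/\ 0 <= nu, 0 <= ln (#|A|%:R : R) & ln #|A|%:R <= nu].
  move=> A0 nU U3; have AT : (#|A| <= #|T|)%N by exact: max_card.
  have T0 : (0 < #|T|)%N by exact: leq_trans A0 AT.
  have nT0 : (0 : R) < #|T|%:R by rewrite ltr0n.
  have U0 : 0 < U by exact: lt_le_trans nU.
  split; split => //.
  - by rewrite ler_ln ?posrE.
  - have : ln (U ^+ 3) <= ln (K * #|T|%:R ^+ 4).
      by rewrite ler_ln ?posrE ?exprn_gt0 // mulr_gt0 ?exprn_gt0 //; lra.
    rewrite lnM ?posrE ?exprn_gt0 //; last by lra.
    by rewrite !lnXn // /k; lra.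
  - by rewrite ln_ge0 // ler1n.
  - by rewrite ln_ge0 // ler1n.
  - by rewrite ler_ln ?posrE ?ltr0n ?ler_nat.
have st_k (i I b v : nat) : (0 < i)%N -> (i <= I)%N -> (0 < b)%N -> (0 < v)%N ->
    st_bound 24 I b v -> st_exp k (ln (b%:R : R)) (ln v%:R) (ln i%:R).
  move=> i0 iI b0 v0 /(st_bound_ln i0 iI b0 v0); rewrite /k.
  by case=> [[h1 h2]|[h1 h2]|h]; [apply: Or31|apply: Or32|apply: Or33];
    try split=> //; lra.
elim/ltn_ind: m c => -[|[|[|m]]] IH c c0.
- exists (expR (k + c)); first exact: expR_gt0.
  move=> T I rl [|//] U V A _ nU U3 _ _ V0 A0 w /=.
  have [[T0 U0 h1 h2] [h3 h4 h5]] := basics T U A A0 nU U3.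
  rewrite sum1_card mulr1 -expr2.
  apply: le_expR_mul; rewrite ?mulr_gt0 ?exprn_gt0 ?ltr0n //.
  rewrite lnM ?posrE ?ltr0n // lnXn ?ltr0n //.
  by case: w => [w|[w w']]; lra.
- exists (expR (10 * (k + c))); first exact: expR_gt0.
  move=> T I rl [|d [|//]] // U V A _ nU U3 gd _ V0 A0 w /=.
  have [[T0 U0 h1 h2] [h3 h4 h5]] := basics T U A A0 nU U3.
  have [st iU] := gd d (mem_head _ _) A [set: T].
  have -> : (\sum_(x in A) \sum_(y | rl d x y) 1)%N = inc (rl d) A [set: T].
    rewrite incE; transitivity (\sum_(x in A) \sum_(y in [set: T] | rl d x y) 1)%N.
      by apply: eq_bigr => x _; apply: eq_bigl => y; rewrite inE.
    by rewrite sum_degree; apply: eq_bigr => y _; rewrite muln1.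
  have L1 : (1 : R) <= (ndyadic T)%:R ^+ 1 by rewrite expr1 ler1n.
  have [i0|i0] := posnP (inc (rl d) A [set: T]).
    by rewrite i0 mulr0 ?mulr_ge0 ?expR_ge0 // ltW.
  apply: le_trans (_ : expR (10 * (k + c)) * (#|T|%:R * U) <= _); last first.
    by rewrite -mulrA ler_pM2l ?expR_gt0 // ler_peMl // mulr_ge0 // ltW.
  apply: le_expR_mul; rewrite ?mulr_gt0 ?ltr0n //.
  rewrite !lnM ?posrE ?ltr0n //.
  rewrite cardsT in st; have := st_k _ _ _ _ i0 (leqnn _) A0 T0 st.
  have : ln ((inc (rl d) A [set: T])%:R : R) <= ln U by rewrite ler_ln ?posrE ?ltr0n.
  set i := ln (inc _ _ _)%:R => iu s.
  by case: w => [w|[w w']]; case: s => [[? ?]|[? ?]|?]; lra.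
- exists (2 * expR (k + c)); first by rewrite mulr_gt0 ?expR_gt0.
  move=> T I rl [|d [|d' [|//]]] // U V A _ nU U3 _ ts V0 A0 w.
  have [[T0 U0 h1 h2] [h3 h4 h5]] := basics T U A A0 nU U3.
  have tsd : two_steps (rl d) (rl d') by apply: ts; rewrite !inE eqxx ?orbT.
  have le2 : (\sum_(x in A) walks (map rl [:: d; d']) x <= 2 * #|A| * #|T|)%N.
    have := sum_two_steps A [set: T] [set: T] (fun=> 1%N) tsd.
    rewrite sum1_card cardsT; apply: leq_trans.
    rewrite leq_eqVlt; apply/orP; left; apply/eqP; apply: eq_bigr => x _.
    by apply: eq_big => [y|y _]; rewrite ?inE //; apply: eq_bigl => z; rewrite inE.
  have L1 : (1 : R) <= (ndyadic T)%:R ^+ 2 by rewrite expr_ge1 // ler1n.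
  apply: le_trans (_ : 2 * (V * #|A|%:R) * #|T|%:R <= _).
    apply: le_trans (ler_wpM2l (ltW V0) (_ : _ <= (2 * #|A| * #|T|)%:R)) _.
      by rewrite ler_nat.
    by rewrite !natrM; lra.
  have VA : V * #|A|%:R <= expR (k + c) * #|T|%:R ^+ 2.
    apply: le_expR_mul; rewrite ?mulr_gt0 ?exprn_gt0 ?ltr0n //.
    rewrite lnM ?posrE ?ltr0n // lnXn ?ltr0n //.
    by case: w => [w|[w w']]; lra.
  rewrite /walk_target; set n := (#|T|%:R : R) in VA *; move: L1.
  move: ((ndyadic T)%:R ^+ 2) => L L1.
  apply: le_trans (_ : 2 * expR (k + c) * (n * n ^+ 2) <= _); last first.
    have n0 : 0 <= n by rewrite ler0n.
    by rewrite -!mulrA ler_pM2l // ler_pM2l ?expR_gt0 // ler_peMl // !mulr_ge0.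
  have n0 : 0 <= n by rewrite ler0n.
  have := ler_wpM2r n0 VA; lra.
have ltm : (m < m.+3)%N by lia.
have c'0 : 0 <= 100 * (k + c) by lra.
have [C C0 CP] := IH m ltm _ c'0.
exists C => // T I rl [|d1 [|d2 [|d3 ds]]] // U V A [sz] nU U3 gd ts V0 A0 w.
have [[T0 U0 h1 h2] [h3 h4 h5]] := basics T U A A0 nU U3.
have n0 : (0 : R) < #|T|%:R by rewrite ltr0n.
rewrite [map _ _]/= walks_split.
pose bnd := #|T|%:R * (C * (ndyadic T)%:R ^+ m * (#|T|%:R * walk_target m #|T|%:R U)).
(* There are [ndyadic ^ 3] triples of classes, so it is enough to bound each triple; this is the
   source of the logarithmic factors. *)
suff each a b g :
    V * (block_sum (rl d1) (rl d2) (rl d3) A a b g (walks (map rl ds)))%:R <= bnd.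
  apply: le_trans (_ : (ndyadic T)%:R ^+ 3 * bnd <= _); last first.
    rewrite le_eqVlt; apply/orP; left; apply/eqP; rewrite /bnd [walk_target m.+3 _ _]/=.
    by rewrite (_ : m.+3 = 3 + m)%N // exprD; ring.
  rewrite !natr_sum big_distrr /=.
  have sumN (F : 'I_(ndyadic T) -> R) x : (forall i, F i <= x) -> \sum_i F i <= (ndyadic T)%:R * x.
    move=> Fx; apply: le_trans (ler_sum _ (fun i _ => Fx i)) _.
    by rewrite sumr_const card_ord mulr_natl.
  rewrite !exprS expr0 mulr1 -!mulrA.
  apply: (sumN) => a; rewrite natr_sum big_distrr /=.
  apply: (sumN) => b; rewrite natr_sum big_distrr /=.
  by apply: (sumN) => g.
set A1 := dyadic_class (rl d1) A a; set A2 := dyadic_class (rl d2) A1 b.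
set A3 := dyadic_class (rl d3) A2 g.
set S := (\sum_(t in A3) walks (map rl ds) t)%N.
have bl1 := block_le_degrees (rl d1) (rl d2) (rl d3) A a b g (walks (map rl ds)).
have ts12 : two_steps (rl d1) (rl d2) by apply: ts; rewrite !inE eqxx ?orbT.
have ts23 : two_steps (rl d2) (rl d3) by apply: ts; rewrite !inE eqxx ?orbT.
have bl2 := block_le_start (rl d3) A a b g (walks (map rl ds)) ts12.
have bl3 := block_le_middle (rl d1) A a b g (walks (map rl ds)) ts23.
move: bl1 bl2 bl3; rewrite -/A1 -/A2 -/A3 -/S; set bs := block_sum _ _ _ _ _ _ _ _.
move=> bl1 bl2 bl3.
have bnd0 : 0 <= bnd by rewrite /bnd !mulr_ge0 ?exprn_ge0 ?walk_target_ge0 ?(ltW C0) ?(ltW U0).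
have [A30|A30] := posnP #|A3|.
  have S0 : S = 0%N by rewrite /S (cards0_eq A30) big_set0.
  by move: bl1; rewrite S0 muln0 leqn0 => /eqP->; rewrite mulr0.
have dc_pos (e : rel T) (B : {set T}) j : (0 < #|dyadic_class e B j|)%N -> (0 < #|B|)%N.
  move=> /card_gt0P[y]; rewrite inE => /andP[/card_gt0P[x]]; rewrite inE => /andP[xB _] _.
  by apply/card_gt0P; exists x.
have A20 := dc_pos _ _ _ A30; have A10 := dc_pos _ _ _ A20.
have [al0 be0 ga0] : [/\ (0 : R) < (2 ^ a)%:R, (0 : R) < (2 ^ b)%:R & (0 : R) < (2 ^ g)%:R].
  by rewrite !ltr0n !expn_gt0.
pose al : R := (2 ^ a)%:R; pose be : R := (2 ^ b)%:R; pose ga : R := (2 ^ g)%:R.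
rewrite -/al -/be -/ga in al0 be0 ga0.
pose M1 := 8 * al * be * ga; pose M2 := 4 * #|A|%:R * ga; pose M3 := 4 * al * #|A1|%:R.
have [M10 M20 M30] : [/\ 0 < M1, 0 < M2 & 0 < M3].
  by split; do !apply: mulr_gt0 => //; rewrite ltr0n.
(* All three bounds on the growth of the block have to hold at once, since the linear program uses
   them together. *)
pose M := Num.min (Num.min M1 M2) M3.
have M0 : 0 < M by rewrite !lt_min M10 M20.
have bsM : bs%:R <= M * S%:R :> R.
  have minS x y : bs%:R <= x * S%:R -> bs%:R <= y * S%:R -> bs%:R <= Num.min x y * S%:R :> R.
    by rewrite /Num.min; case: ifP.
  apply: (minS); first apply: (minS).
  - apply: le_trans (_ : (2 ^ a.+1 * 2 ^ b.+1 * 2 ^ g.+1 * S)%:R <= _); first by rewrite ler_nat.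
    by rewrite !natrM !expnS !natrM /M1 /al /be /ga; lra.
  - apply: le_trans (_ : (2 * #|A| * 2 ^ g.+1 * S)%:R <= _); first by rewrite ler_nat.
    by rewrite !natrM !expnS !natrM /M2 /ga; lra.
  - apply: le_trans (_ : (2 ^ a.+1 * (2 * #|A1|) * S)%:R <= _); first by rewrite ler_nat.
    by rewrite !natrM !expnS !natrM /M3 /al; lra.
have ln4 : ln (4 : R) <= ln 8 by rewrite ler_ln ?posrE // ler_nat.
have ln4' : 0 <= ln (4 : R) by rewrite ln_ge0 // ler1n.
have lM1 : ln M <= ln 8 + ln al + ln be + ln ga.
  rewrite -!lnM ?posrE ?mulr_gt0 // ler_ln ?posrE //.
  by rewrite /M !ge_min lexx.
have A0' : (0 : R) < #|A|%:R by rewrite ltr0n.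
have A10' : (0 : R) < #|A1|%:R by rewrite ltr0n.
have lM2 : ln M <= ln 4 + ln #|A|%:R + ln ga.
  rewrite -!lnM ?posrE ?mulr_gt0 // ler_ln ?posrE //.
  by rewrite /M !ge_min lexx orbT.
have lM3 : ln M <= ln 4 + ln al + ln #|A1|%:R.
  rewrite -!lnM ?posrE ?mulr_gt0 // ler_ln ?posrE //.
  by rewrite /M !ge_min lexx orbT.
have stc (d : I) (B : {set T}) j : d \in [:: d1, d2, d3 & ds] ->
    (0 < #|B|)%N -> (0 < #|dyadic_class (rl d) B j|)%N ->
    st_exp k (ln (#|B|%:R : R)) (ln #|dyadic_class (rl d) B j|%:R)
      (ln (2 ^ j)%:R + ln #|dyadic_class (rl d) B j|%:R) /\
    ln (2 ^ j)%:R + ln #|dyadic_class (rl d) B j|%:R <= k + ln U.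
  move=> dd B0 D0; have [st iU] := gd d dd B (dyadic_class (rl d) B j).
  have cd := card_dyadic_class (rl d) B j.
  have p0 : (0 < 2 ^ j * #|dyadic_class (rl d) B j|)%N by rewrite muln_gt0 expn_gt0.
  rewrite -lnM ?posrE ?ltr0n ?expn_gt0 // -natrM; split; first exact: st_k p0 cd B0 D0 st.
  have : ln ((2 ^ j * #|dyadic_class (rl d) B j|)%:R : R) <= ln U.
    by rewrite ler_ln ?posrE ?ltr0n //; apply: le_trans iU; rewrite ler_nat.
  by lra.
have [s1 u1] := stc d1 A a (mem_head _ _) A0 A10.
have [|s2 _] := stc d2 A1 b _ A10 A20; first by rewrite !inE eqxx orbT.
have [|s3 _] := stc d3 A2 g _ A20 A30; first by rewrite !inE eqxx !orbT.
have [_ [_ q1 q2]] := basics T U A1 A10 nU U3.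
have [_ [_ q3 q4]] := basics T U A2 A20 nU U3.
have [_ [_ q5 q6]] := basics T U A3 A30 nU U3.
(* The induction continues from the end points [A3] with weight [V * M / n]; the division accounts
   for the factor n which the target gains in this block. *)
have w3 : weight_exp (100 * (k + c)) (ln #|T|%:R) (ln U) (ln (V * M / #|T|%:R)) (ln #|A3|%:R).
  have -> : ln (V * M / #|T|%:R) = ln V + ln M - ln #|T|%:R.
    by rewrite ln_div ?posrE ?mulr_gt0 // lnM ?posrE.
  apply: (@weight_exp_step _ k c _ _ _ (ln #|A|%:R) (ln #|A1|%:R) (ln #|A2|%:R) _
    (ln al) (ln be) (ln ga)) => //; rewrite /k; lra.
have V'0 : 0 < V * M / #|T|%:R by rewrite divr_gt0 ?mulr_gt0.
have gd' : {in ds, forall d, good_relation U (rl d)}.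
  by move=> d dd; apply: gd; rewrite !inE dd !orbT.
have ts' : {in ds &, forall d d', two_steps (rl d) (rl d')}.
  by move=> d d' dd dd'; apply: ts; rewrite !inE ?dd ?dd' !orbT.
have := CP T I rl ds U _ A3 sz nU U3 gd' ts' V'0 A30 w3.
move=> /(ler_wpM2l (ltW n0)); rewrite -/bnd; apply: le_trans.
have -> : #|T|%:R * (V * M / #|T|%:R * (\sum_(x in A3) walks [seq rl i | i <- ds] x)%:R)
    = V * (M * S%:R) by rewrite -/S; field; rewrite gt_eqF.
by rewrite ler_pM2l.
Qed.

End WalkBound.

(** * From chains of distinct points to walks *)

Section ChainCount.
Variable T : finType.

Fixpoint follows (T : Type) (es : seq (rel T)) (x : T) (s : seq T) : bool :=
  match es, s with
  | [::], [::] => true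
  | e :: es', y :: s' => e x y && follows es' y s'
  | _, _ => false
  end.

Definition nfollows es m x := #|[set s : m.-tuple T | follows es x s && uniq (x :: s)]|.

Lemma card_tuple_cons m (P : pred (seq T)) :
  #|[set s : m.+1.-tuple T | P s]| = (\sum_x #|[set s : m.-tuple T | P (x :: s)]|)%N.
Proof.
under eq_bigr do rewrite -sum1dep_card.
rewrite -sum1dep_card pair_big_dep /=.
rewrite (reindex (fun u : T * m.-tuple T => [tuple of u.1 :: u.2])) //=.
exists (fun s : m.+1.-tuple T => (thead s, [tuple of behead s])) => [[x s] _|s _] /=.
  by congr pair; apply: val_inj.
by rewrite [RHS]tuple_eta.
Qed.

(** Distinctness of all vertices implies the two inequations inside each block, and everything else
    about it is dropped. The tuple length is independent of [es]: if they differ, there is nothing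
    to count. *)
Lemma nfollows_le_walks es m x : (nfollows es m x <= walks es x)%N.
Proof.
have le_imp (j : nat) (P Q : pred (seq T)) : (forall s, P s -> Q s) ->
    (#|[set s : j.-tuple T | P s]| <= #|[set s : j.-tuple T | Q s]|)%N.
  by move=> PQ; apply/subset_leq_card/fintype.subsetP => s; rewrite !inE => /PQ.
have card0 (j : nat) (P : pred (seq T)) c : (forall s, ~~ P s) ->
    (#|[set s : j.-tuple T | P s]| <= c)%N.
  by move=> P0; apply: leq_trans (leq0n c); rewrite leqn0 cards_eq0; apply/eqP/setP => s;
    rewrite !inE (negbTE (P0 s)).
have nil j y (R : pred (seq T)) : (#|[set s : j.-tuple T | follows [::] y s && R s]| <= 1)%N.
  apply/card_le1_eqP => -[s /= i] [s' /= i']; rewrite !inE /= => /andP[h _] /andP[h' _].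
  by apply: val_inj => /=; case: s s' h h' {i i'} => [|? ?] [|? ?].
have step e es' j y (R : pred (seq T)) :
    (#|[set s : j.-tuple T | follows (e :: es') y s && R s]| <=
     \sum_(z | e y z) #|[set s : j.-1.-tuple T | follows es' z s && R (z :: s)]|)%N.
  case: j => [|j].
    rewrite [X in (X <= _)%N](_ : _ = 0)%N //; apply/eqP; rewrite cards_eq0.
    by apply/eqP/setP => s; rewrite !inE tuple0.
  rewrite (card_tuple_cons j (fun s => follows (e :: es') y s && R s)) [X in (_ <= X)%N]big_mkcond.
  apply: leq_sum => z _ /=; case: (e y z) => //=.
  by rewrite leqn0 cards_eq0; apply/eqP/setP => s; rewrite !inE.
have split2 (P Q : pred T) (F : T -> nat) :
    (forall z, P z -> ~~ Q z -> F z = 0)%N -> (\sum_(z | P z) F z = \sum_(z | P z && Q z) F z)%N.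
  move=> h; rewrite (bigID Q) /= [X in (_ + X)%N]big1 ?addn0 // => z /andP[Pz Qz].
  exact: h.
have un0 (j : nat) es' z (s0 : seq T) : ~~ uniq s0 ->
    #|[set s : j.-tuple T | follows es' z s && uniq (s0 ++ s)]| = 0%N.
  move=> nu; apply/eqP; rewrite cards_eq0; apply/eqP/setP => s.
  by rewrite !inE cat_uniq (negbTE nu) andbF.
elim: {es}_.+1 {-2}es (ltnSn (size es)) m x => // N IH [|e1 [|e2 [|e3 es]]] szN m x.
- exact: (nil m x (fun s => uniq (x :: s))).
- apply: leq_trans (step _ _ _ _ (fun s => uniq (x :: s))) _; apply: leq_sum => y _.
  exact: (nil m.-1 y (fun s => uniq (x :: y :: s))).
- apply: leq_trans (step _ _ _ _ (fun s => uniq (x :: s))) _; apply: leq_sum => y _.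
  apply: leq_trans (step _ _ _ _ (fun s => uniq (x :: y :: s))) _.
  rewrite (split2 _ (fun z => x != z)); last first.
    move=> z _; rewrite negbK => /eqP<-; apply: (un0 _ _ _ [:: x; y; x]).
    by rewrite /= !inE eqxx orbT.
  apply: leq_sum => z _.
  exact: (nil m.-1.-1 z (fun s => uniq (x :: y :: z :: s))).
apply: leq_trans (step _ _ _ _ (fun s => uniq (x :: s))) _; apply: leq_sum => y _.
apply: leq_trans (step _ _ _ _ (fun s => uniq (x :: y :: s))) _.
rewrite (split2 _ (fun z => x != z)); last first.
  move=> z _; rewrite negbK => /eqP<-; apply: (un0 _ _ _ [:: x; y; x]).
  by rewrite /= !inE eqxx orbT.
apply: leq_sum => z _.
apply: leq_trans (step _ _ _ _ (fun s => uniq (x :: y :: z :: s))) _.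
rewrite (split2 _ (fun t => y != t)); last first.
  move=> t _; rewrite negbK => /eqP<-; apply: (un0 _ _ _ [:: x; y; z; y]).
  by rewrite /= !inE eqxx !orbT ?andbF.
apply: leq_sum => t _.
apply: leq_trans (IH es _ m.-1.-1.-1 t); last by move: szN => /=; lia.
apply: (le_imp _ (fun s => follows es t s && uniq [:: x, y, z, t & s])
  (fun s => follows es t s && uniq (t :: s))) => s.
by case/andP=> -> /and4P[_ _ _ un]; exact: un.
Qed.

Lemma follows_nth (es : seq (rel T)) x s (e0 : rel T) (x0 : T) : size s = size es ->
  (forall j, (j < size es)%N -> nth e0 es j (nth x0 (x :: s) j) (nth x0 (x :: s) j.+1)) ->
  follows es x s.
Proof.
elim: es x s => [|e es IH] x [|y s] //= [sz] h.
have := h 0%N isT; rewrite /= => ->; apply: IH => // j jes.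
exact: (h j.+1 jes).
Qed.

End ChainCount.

Section UpperBound.
Variable R : realType.

Definition at_dist (n : nat) (p : 'I_n -> R * R) (d : R) : rel 'I_n :=
  fun x y => dist2 (p x) (p y) == d.

Lemma nchains_le_walks (k n : nat) (delta : 'I_k -> R) (p : 'I_n -> R * R) :
  (nchains delta p <= \sum_x walks (map (at_dist p) (codom delta)) x)%N.
Proof.
set es := map _ _.
have szes : size es = k by rewrite size_map size_codom card_ord.
apply: leq_trans (leq_sum _ (fun x _ => nfollows_le_walks es k x)).
pose good (s : seq 'I_n) := if s is x :: s' then follows es x s' && uniq (x :: s') else false.
rewrite -(card_tuple_cons k good).
apply: (@leq_card_rel _ _ _ _ (fun (f : {ffun 'I_k.+1 -> 'I_n}) s => s = mktuple f)); last first.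
  move=> f g _ _ _ -> fg; apply/ffunP => i.
  by have := congr1 (fun s => tnth s i) fg; rewrite !tnth_mktuple.
move=> f; rewrite inE => /andP[/injectiveP f_inj /forallP fd].
exists (mktuple f) => //; rewrite inE /good.
have nth_f j x0 : (j < k.+1)%N -> nth x0 (mktuple f) j = f (inord j).
  by move=> jk; rewrite -(nth_mktuple f x0 (inord j)) inordK.
have un : uniq (mktuple f) by rewrite map_inj_uniq ?enum_uniq.
case E : (tval (mktuple f)) => [|x s]; first by have := size_tuple (mktuple f); rewrite E.
have sz : size s = k by have := size_tuple (mktuple f); rewrite E => -[].
rewrite -E un andbT; apply: (follows_nth (e0 := fun _ _ => true) (x0 := x)).
  by rewrite sz szes.
rewrite szes -E => j jk.
rewrite !nth_f ?ltnS // 1?ltnW //.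
rewrite (nth_map 0) ?size_codom ?card_ord // /at_dist.
have -> : nth 0 (codom delta) j = delta (Ordinal jk).
  rewrite codomE (nth_map (Ordinal jk)) ?size_enum_ord //; congr delta.
  by apply: val_inj; rewrite /= nth_enum_ord.
exact: (fd (Ordinal jk)).
Qed.

Lemma integer_points_inj n : injective (fun i : 'I_n => ((i : nat)%:R, 0) : R * R).
Proof. by move=> i j [] /eqP; rewrite eqr_nat => /eqP/val_inj. Qed.

Lemma nunit_le_u2 n (p : 'I_n -> R * R) : injective p -> (nunit p <= u2 R n)%N.
Proof.
move=> p_inj; have lt : (nunit p < (n ^ 2).+1)%N.
  by rewrite ltnS; apply: leq_trans (max_card _) _; rewrite card_prod card_ord mulnn.
rewrite -[X in (X <= _)%N]/(val (Ordinal lt)) /u2.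
by apply: leq_bigmax_cond; apply/asboolP; exists p.
Qed.

Lemma u2_attained n : exists2 p : 'I_n -> R * R, injective p & nunit p = u2 R n.
Proof.
pose P := fun m : 'I_(n ^ 2).+1 => `[< exists p : 'I_n -> R * R, injective p /\ nunit p = m >].
(* The maximum over achievable values is attained once some injective configuration exists;
   collinear points provide one. *)
pose p0 (i : 'I_n) : R * R := ((i : nat)%:R, 0).
have lt : (nunit p0 < (n ^ 2).+1)%N.
  by rewrite ltnS; apply: leq_trans (max_card _) _; rewrite card_prod card_ord mulnn.
have P0 : P (Ordinal lt) by apply/asboolP; exists p0; split=> //; exact: integer_points_inj.
have [|m Pm mE] := @eq_bigmax_cond _ P val; first by apply/card_gt0P; exists (Ordinal lt).
have /asboolP[p [p_inj pm]] : P m by [].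
by exists p => //; rewrite pm /u2 -mE.
Qed.

Lemma nchains_le_C2 k n (delta : 'I_k -> R) (p : 'I_n -> R * R) : injective p ->
  (nchains delta p <= C2 delta n)%N.
Proof.
move=> p_inj; have lt : (nchains delta p < (n ^ k.+1).+1)%N.
  by rewrite ltnS; apply: leq_trans (max_card _) _; rewrite card_ffun !card_ord.
rewrite -[X in (X <= _)%N]/(val (Ordinal lt)) /C2.
by apply: leq_bigmax_cond; apply/asboolP; exists p.
Qed.

Lemma C2_attained k n (delta : 'I_k -> R) :
  exists2 p : 'I_n -> R * R, injective p & nchains delta p = C2 delta n.
Proof.
pose P := fun m : 'I_(n ^ k.+1).+1 =>
  `[< exists p : 'I_n -> R * R, injective p /\ nchains delta p = m >].
pose p0 (i : 'I_n) : R * R := ((i : nat)%:R, 0).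
have lt : (nchains delta p0 < (n ^ k.+1).+1)%N.
  by rewrite ltnS; apply: leq_trans (max_card _) _; rewrite card_ffun !card_ord.
have P0 : P (Ordinal lt) by apply/asboolP; exists p0; split=> //; exact: integer_points_inj.
have [|m Pm mE] := @eq_bigmax_cond _ P val; first by apply/card_gt0P; exists (Ordinal lt).
have /asboolP[p [p_inj pm]] : P m by [].
by exists p => //; rewrite pm /C2 -mE.
Qed.

(** After scaling by [1 / d] the incidences are unit distances; the factor 2 is for the two orders
    of a pair. *)
Lemma inc_le_u2 n (p : 'I_n -> R * R) (d : R) (A B : {set 'I_n}) :
  injective p -> 0 < d -> (inc (at_dist p d) A B <= 2 * u2 R n)%N.
Proof.
move=> p_inj d0; pose p' i := ((p i).1 / d, (p i).2 / d).
have d_neq0 : d != 0 by rewrite gt_eqF.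
have p'_inj : injective p'.
  move=> i j [/(mulIf (invr_neq0 d_neq0)) e1 /(mulIf (invr_neq0 d_neq0)) e2].
  by apply: p_inj; rewrite [LHS]surjective_pairing e1 e2 -surjective_pairing.
have p'1 i j : at_dist p d i j -> dist2 (p' i) (p' j) = 1.
  move=> /eqP/(dist2_sqr _ _ (ltW d0)) e; apply/(dist2_sqr _ _ ler01).
  rewrite /p' /= expr1n -!mulrBl !exprMn -mulrDl e -exprMn divff // expr1n.
  by [].
pose S := [set ij : 'I_n * 'I_n | (ij.1 < ij.2)%N && (dist2 (p' ij.1) (p' ij.2) == 1)].
apply: leq_trans (_ : 2 * #|S| <= _)%N; last by rewrite leq_mul2l nunit_le_u2.
rewrite mul2n -addnn.
have swapK : injective (fun x : 'I_n * 'I_n => (x.2, x.1)) by move=> [? ?] [? ?] [-> ->].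
rewrite -[X in (_ <= _ + X)%N](card_imset _ swapK).
apply: leq_trans (leq_card_setU _ _); apply/subset_leq_card/fintype.subsetP => -[i j].
rewrite inE /= => /andP[_ dij].
have [ij|ji|/val_inj ij] := ltngtP i j.
- by rewrite !inE /= ij p'1 ?eqxx.
- rewrite inE; apply/orP; right; apply/imsetP; exists (j, i) => //.
  by rewrite inE /= ji dist2C p'1 ?eqxx.
- move: (p'1 _ _ dij); rewrite ij => /(dist2_sqr _ _ ler01)/eqP.
  by rewrite !subrr !expr0n /= addr0 expr1n eq_sym oner_eq0.
Qed.

Lemma u2_cube n : (0 < n)%N -> (u2 R n ^ 3 <= 24 ^ 3 * n ^ 4)%N.
Proof.
move=> n0; have [p p_inj <-] := u2_attained n.
have le : (nunit p <= incidences p (1 : R) [set: 'I_n] [set: 'I_n])%N.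
  by apply/subset_leq_card/fintype.subsetP => x; rewrite !inE /= => /andP[].
apply: leq_trans (_ : incidences p (1 : R) [set: 'I_n] [set: 'I_n] ^ 3 <= _)%N.
  by rewrite leq_exp2r.
have n34 : (n ^ 3 <= n ^ 4)%N by rewrite leq_pexp2l.
have := szemeredi_trotter [set: 'I_n] [set: 'I_n] p_inj ltr01.
rewrite cardsT card_ord; case=> [[_ h]|[_ h]|]; last by rewrite -expnD.
- apply: leq_trans (_ : (24 * n) ^ 3 <= _)%N; first by rewrite leq_exp2r.
  by rewrite expnMn leq_mul2l n34 orbT.
- apply: leq_trans (_ : (24 * n) ^ 3 <= _)%N; first by rewrite leq_exp2r.
  by rewrite expnMn leq_mul2l n34 orbT.
Qed.

(** The walk bound is applied with all points as starting set and weight n, so the invariant holds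
    trivially with constant 0. Adding n to twice [u2] guarantees U >= n. *)
Lemma C2_upper k (delta : 'I_k -> R) : (forall j, 0 < delta j) ->
  exists2 C : R, 0 < C & forall n, (0 < n)%N ->
    (C2 delta n)%:R <=
      C * ((trunc_log 2 n).+1)%:R ^+ k * walk_target k n%:R (2 * (u2 R n)%:R + n%:R).
Proof.
move=> d0; have K1 : (1 : R) <= 36 * 24 ^+ 3 by lra.
have [C C0 CP] := walks_bound k K1 (lexx 0).
exists C => // n n0; have [p p_inj <-] := C2_attained n delta.
apply: le_trans (_ : (\sum_x walks (map (at_dist p) (codom delta)) x)%:R <= _).
  by rewrite ler_nat nchains_le_walks.
have n0' : (0 : R) < n%:R by rewrite ltr0n.
rewrite -(ler_pM2l n0').
have := CP 'I_n _ (at_dist p) (codom delta) (2 * (u2 R n)%:R + n%:R) n%:R [set: 'I_n].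
rewrite size_codom card_ord => /(_ erefl).
have u0 : (0 : R) <= (u2 R n)%:R by [].
have dpos d : d \in codom delta -> 0 < d by move=> /codomP[j ->].
move=> /(_ _ _ _ _ n0' _ _); rewrite /ndyadic cardsT card_ord.
have -> : (\sum_(x in [set: 'I_n]) walks [seq at_dist p i | i <- codom delta] x)%N =
  (\sum_x walks [seq at_dist p i | i <- codom delta] x)%N by apply: eq_bigl => x; rewrite inE.
move=> h; apply: le_trans (h _ _ _ _ n0 _) _.
- by lra.
- have := u2_cube n0; rewrite -(ler_nat R) natrM !natrX => u3.
  have n34 : (n%:R : R) ^+ 3 <= n%:R ^+ 4.
    by rewrite ler_weXn2l // ler1n.
  set u := (u2 R n)%:R in u0 u3 *; set N := n%:R : R in n0' u3 n34 *.
  (* This is (a+b)^3 <= 4(a^3+b^3), whose defect is 3(a+b)(a-b)^2; together with the cubic bound on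
     [u2] it produces the constant [36 * 24 ^+ 3]. *)
  apply: le_trans (_ : 4 * ((2 * u) ^+ 3 + N ^+ 3) <= _).
    suff : 0 <= 3 * (2 * u + N) * (2 * u - N) ^+ 2 by lra.
    by apply: mulr_ge0; [lra|exact: sqr_ge0].
  have N4 : 0 <= N ^+ 4 by rewrite exprn_ge0 // ltW.
  rewrite exprMn; lra.
- move=> d /dpos dd A B; split; last first.
    have := inc_le_u2 A B p_inj dd; rewrite -(ler_nat R) natrM; lra.
  exact: szemeredi_trotter.
- move=> d d' /dpos dd /dpos dd' x z xz; apply: card_circle_inter => //; exact: ltW.
- by left; rewrite add0r.
- by rewrite [leRHS]mulrCA.
Qed.

End UpperBound.

(** * Constructions *)

Section Geometry.
Variable R : realType.

Lemma avoid_finite (s : seq R) (a b : R) : a < b -> exists2 x, a < x < b & x \notin s.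
Proof.
move=> ab; pose f (i : nat) : R := a + (b - a) / i.+2%:R.
have f_inj : injective f.
  move=> i j /addrI/(mulfI _); rewrite subr_eq0 gt_eqF // => /(_ isT)/invr_inj/eqP.
  by rewrite eqr_nat => /eqP[].
have fab i : a < f i < b.
  have i0 : (0 : R) < i.+2%:R by rewrite ltr0n.
  have q0 : 0 < (b - a) / i.+2%:R by rewrite divr_gt0 // subr_gt0.
  have q1 : (b - a) / i.+2%:R < b - a.
    by rewrite ltr_pdivrMr // ltr_pMr ?subr_gt0 // ltr1n.
  by rewrite /f; move: (_ / _) q0 q1 => q q0 q1; apply/andP; split; lra.
have [/allP all_s|/allPn[x /mapP[i _ ->] xs]] := boolP (all (mem s) (map f (iota 0 (size s).+1))).
  have : (size (map f (iota 0 (size s).+1)) <= size s)%N.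
    by apply: uniq_leq_size; [rewrite map_inj_uniq // iota_uniq|move=> x /all_s].
  by rewrite size_map size_iota ltnn.
by exists (f i) => //; exact: fab.
Qed.

(** Constructions may use fewer than n points; fresh abscissae fill the set up to exactly n points
    and no chain is lost. *)
Lemma pad_points (X : seq (R * R)) (n : nat) : uniq X -> (size X <= n)%N ->
  exists2 p : 'I_n -> R * R, injective p & forall x, x \in X -> exists i, p i = x.
Proof.
move=> uX sX.
have ext m (Z : seq (R * R)) : uniq Z -> exists Y,
    [/\ uniq Y, size Y = (size Z + m)%N & {subset Z <= Y}].
  elim: m Z => [|m IH] Z uZ; first by exists Z; rewrite addn0; split.
  have [x _ xZ] := avoid_finite (map fst Z) (@ltr01 R).
  have uZ' : uniq ((x, 0) :: Z).
    by rewrite /= uZ andbT; apply: contra xZ => xZ; apply/mapP; exists (x, 0).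
  have [Y [uY sY ZY]] := IH _ uZ'.
  exists Y; split=> //; first by rewrite sY /= addSnnS.
  by move=> y yZ; apply: ZY; rewrite inE yZ orbT.
have [Y [uY sY XY]] := ext (n - size X)%N _ uX; rewrite subnKC // in sY.
exists (fun i => nth (0, 0) Y i).
  move=> i j /eqP; rewrite nth_uniq ?sY // => /eqP; exact: val_inj.
move=> x /XY xY; have ix : (index x Y < n)%N by rewrite -sY index_mem.
by exists (Ordinal ix); rewrite /= nth_index.
Qed.

(** The points cluster at the rational point (3/5, 4/5) of the circle, scaled by [d], which avoids
    trigonometry and gives all of them positive abscissa. *)
Lemma circle_points (d eta : R) (N : nat) : 0 < d -> 0 < eta ->
  exists2 P : seq (R * R), uniq P /\ size P = N &
  forall p, p \in P -> [/\ p.1 ^+ 2 + p.2 ^+ 2 = d ^+ 2, 0 < p.1,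
     `|p.1 - 3 / 5 * d| < eta & `|p.2 - 4 / 5 * d| < eta].
Proof.
move=> d0 eta0; pose m : R := Num.min (eta / 4) (d / 10).
have m0 : 0 < m by rewrite lt_min !divr_gt0.
have m1 : m <= eta / 4 by rewrite ge_min lexx.
have m2 : m <= d / 10 by rewrite ge_min lexx orbT.
pose t (i : nat) : R := 3 / 5 * d + m / i.+1%:R.
have t_inj : injective t.
  move=> i j /addrI/(mulfI _); rewrite gt_eqF // => /(_ isT)/invr_inj/eqP.
  by rewrite eqr_nat => /eqP[].
have tb i : 3 / 5 * d < t i /\ t i <= 3 / 5 * d + m.
  have q0 : 0 < m / i.+1%:R by rewrite divr_gt0 // ltr0n.
  have q1 : m / i.+1%:R <= m by rewrite ler_pdivrMr ?ltr0n // ler_peMr ?ler1n // ltW.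
  by rewrite /t; move: (m / _) q0 q1 => q q0 q1; split; lra.
pose f i := (t i, Num.sqrt (d ^+ 2 - t i ^+ 2)).
exists (map f (iota 0 N)).
  by rewrite map_inj_uniq ?iota_uniq ?size_map ?size_iota // => i j [] /t_inj.
move=> p /mapP[i _ ->] /=; have [t1 t2] := tb i; set x := t i in t1 t2 *.
have xx : 0 <= d ^+ 2 - x ^+ 2 by nra.
set y := Num.sqrt _.
have y0 : 0 <= y by exact: sqrtr_ge0.
have y2 : y ^+ 2 = d ^+ 2 - x ^+ 2 by rewrite sqr_sqrtr.
have yle : y <= 4 / 5 * d.
  rewrite -(ler_pXn2r (_ : (0 < 2)%N)) ?nnegrE //; last by lra.
  by rewrite y2; nra.
have yge : 4 / 5 * d - y < eta.
  have e : (4 / 5 * d - y) * (4 / 5 * d + y) = (x - 3 / 5 * d) * (x + 3 / 5 * d).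
    by rewrite -subr_sqr -(subr_sqr x) y2; lra.
  have u1 : (4 / 5 * d - y) * (4 / 5 * d) <= m * (2 * d).
    apply: le_trans (_ : (4 / 5 * d - y) * (4 / 5 * d + y) <= _).
      by apply: ler_wpM2l; lra.
    by rewrite e; apply: ler_pM; lra.
  have : (4 / 5 * d - y) * (4 / 5 * d) < eta * (4 / 5 * d).
    apply: le_lt_trans u1 _.
    have : m * (2 * d) <= eta / 4 * (2 * d) by apply: ler_wpM2r => //; lra.
    have : 0 < eta * d by rewrite mulr_gt0.
    lra.
  by rewrite ltr_pM2r //; lra.
split; first by rewrite y2; ring.
- by lra.
- by rewrite ltr_norml; lra.
- by rewrite ltr_norml; lra.
Qed.

Local Open Scope classical_set_scope.

(** With the fixed centre at the origin, the reference position is b = (4/5 d2, -3/5 d2) and v - b =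
    (4/5 d3, 3/5 d3). The two bars are not parallel there, so the explicit intersection point of the
    two circles depends continuously on v and stays strictly between the centre and v in
    abscissa. *)
Lemma linkage (d2 d3 : R) : 0 < d2 -> 0 < d3 ->
  exists2 eta : R, 0 < eta & forall v : R * R,
    `|v.1 - 4 / 5 * (d2 + d3)| < eta -> `|v.2 - 3 / 5 * (d3 - d2)| < eta ->
    exists b : R * R, [/\ b.1 ^+ 2 + b.2 ^+ 2 = d2 ^+ 2,
      (b.1 - v.1) ^+ 2 + (b.2 - v.2) ^+ 2 = d3 ^+ 2,
      0 < b.1 & b.1 < 4 / 5 * (d2 + d3) - eta].
Proof.
move=> d20 d30; set v0 : R * R := (4 / 5 * (d2 + d3), 3 / 5 * (d3 - d2)).
pose D (v : R * R) : R := v.1 * v.1 + v.2 * v.2.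
pose a (v : R * R) : R := (d2 ^+ 2 - d3 ^+ 2 + D v) / 2.
pose hh (v : R * R) : R := d2 ^+ 2 * D v - a v * a v.
pose b1 (v : R * R) : R := (a v * v.1 + Num.sqrt (hh v) * v.2) / D v.
have D0 : D v0 = d2 ^+ 2 + d3 ^+ 2 + 14 / 25 * d2 * d3 by rewrite /D /v0 /=; field.
have Dpos : 0 < D v0.
  by rewrite D0; have := mulr_gt0 d20 d30; have := exprn_gt0 2 d20; have := exprn_gt0 2 d30; lra.
have hh0 : hh v0 = (24 / 25 * d2 * d3) ^+ 2 by rewrite /hh /a D0; field.
have hhpos : 0 < hh v0 by rewrite hh0 exprn_gt0 // !mulr_gt0.
have b10 : b1 v0 = 4 / 5 * d2.
  rewrite /b1 hh0 sqrtr_sqr ger0_norm; last by rewrite !mulr_ge0 // ltW.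
  apply: (mulIf (lt0r_neq0 Dpos)); rewrite divfK ?lt0r_neq0 // /a D0 /v0 /=.
  by field.
have c1 : (fun v : R * R => v.1) v @[v --> v0] --> v0.1 by exact: cvg_fst.
have c2 : (fun v : R * R => v.2) v @[v --> v0] --> v0.2 by exact: cvg_snd.
have cD : D v @[v --> v0] --> D v0 by apply: cvgD; apply: cvgM.
have ca : a v @[v --> v0] --> a v0.
  by apply: cvgM; [apply: cvgD => //; exact: cvg_cst|exact: cvg_cst].
have chh : hh v @[v --> v0] --> hh v0.
  by apply: cvgB; apply: cvgM => //; exact: cvg_cst.
have cb1 : b1 v @[v --> v0] --> b1 v0.
  apply: cvgM; last by apply: cvgV => //; exact: lt0r_neq0.
  apply: cvgD; apply: cvgM => //.
  by apply: (continuous_cvg _ (@sqrt_continuous R _)).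
have nD : \forall v \near v0, 0 < D v by exact: cvgr_gt cD _ Dpos.
have nhh : \forall v \near v0, 0 < hh v by exact: cvgr_gt chh _ hhpos.
have b1pos : 0 < b1 v0 by rewrite b10 mulr_gt0.
have nb1 : \forall v \near v0, 0 < b1 v by exact: cvgr_gt cb1 _ b1pos.
have b1lt : b1 v0 < 4 / 5 * d2 + 2 / 5 * d3 by rewrite b10; lra.
have nb2 : \forall v \near v0, b1 v < 4 / 5 * d2 + 2 / 5 * d3 by exact: cvgr_lt cb1 _ b1lt.
have nall : \forall v \near v0,
    (0 < D v /\ 0 < hh v) /\ (0 < b1 v /\ b1 v < 4 / 5 * d2 + 2 / 5 * d3).
  exact: filterI (filterI nD nhh) (filterI nb1 nb2).
have [e /= e0 be] := (nbhs_ballP _ _).1 nall.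
(* The bound [2 / 5 * d3] turns the estimate on [b1] into a separation by [eta] from the abscissa of
   the reference position. *)
exists (Num.min e (2 / 5 * d3)); first by rewrite lt_min e0 mulr_gt0.
move=> v; rewrite !lt_min => /andP[v1e _] /andP[v2e _].
have vball : ball v0 e v.
  by split; rewrite -ball_normE /= distrC.
have [[vD vhh] [vb1 vb2]] := be v vball.
exists (b1 v, (a v * v.2 - Num.sqrt (hh v) * v.1) / D v) => /=.
set h := Num.sqrt (hh v).
have h2 : h ^+ 2 = d2 ^+ 2 * D v - a v ^+ 2 by rewrite sqr_sqrtr ?ltW.
have Dn : D v != 0 by exact: lt0r_neq0.
have e1 : b1 v ^+ 2 + ((a v * v.2 - h * v.1) / D v) ^+ 2 = d2 ^+ 2.
  have -> : b1 v ^+ 2 + ((a v * v.2 - h * v.1) / D v) ^+ 2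
      = (a v ^+ 2 + h ^+ 2) / D v by rewrite /b1 -/h /D; field.
  by rewrite h2 addrC subrK mulfK.
have e2 : b1 v * v.1 + (a v * v.2 - h * v.1) / D v * v.2 = a v.
  by rewrite /b1 -/h /D; field.
split => //.
- transitivity (d2 ^+ 2 - 2 * a v + D v); last by rewrite /a; field.
  move: e1 e2; set y := (a v * v.2 - h * v.1) / D v; move: y => y.
  by rewrite /D; move: (b1 v) (a v) => x w e1 e2; lra.
- have : Num.min e (2 / 5 * d3) <= 2 / 5 * d3 by rewrite ge_min lexx orbT.
  by lra.
Qed.

Local Close Scope classical_set_scope.

End Geometry.

(** * Configurations with many chains, built from right to left *)

Section RichChains.
Variable R : realType.
Implicit Types (ds : seq R) (z : R * R).

Definition steps ds : seq (rel (R * R)) := [seq (fun x y => dist2 x y == d) | d <- ds].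

(* The chain with first point x and further points s is encoded as (x, s). *)
Definition chain_config ds z (eta : R) (X : seq (R * R)) (S : seq ((R * R) * seq (R * R))) :=
  uniq S /\ forall c, c \in S ->
    [/\ follows (steps ds) c.1 c.2, uniq (c.1 :: c.2), {subset c.1 :: c.2 <= X},
        `|c.1.1 - z.1| < eta /\ `|c.1.2 - z.2| < eta &
        {in c.1 :: c.2, forall q, z.1 - eta <= q.1}].

(* The points of the chains stay to the right of their first point, so that further
   points can be prepended on the left without repetition. *)
Definition rich ds (F : nat -> nat) := forall z (eta : R), 0 < eta ->
  exists2 K : nat, (0 < K)%N & forall N, (0 < N)%N -> exists X S,
    [/\ chain_config ds z eta X S, (size X <= K * N)%N & (F N <= K * size S)%N].

Lemma follows_size (T : Type) (es : seq (rel T)) x s : follows es x s -> size s = size es.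
Proof. by elim: es x s => [|e es IH] x [|y s] //= /andP[_ /IH->]. Qed.

Lemma nth_follows (T : Type) (es : seq (rel T)) x s (e0 : rel T) (x0 : T) j :
  follows es x s -> (j < size es)%N ->
  nth e0 es j (nth x0 (x :: s) j) (nth x0 (x :: s) j.+1).
Proof.
elim: es x s j => [|e es IH] x [|y s] [|j] //=.
  by case/andP.
by case/andP=> _ /IH h /h.
Qed.

Lemma rich_C2 k (delta : 'I_k -> R) F : rich (codom delta) F ->
  exists2 K : nat, (0 < K)%N &
    forall n N, (0 < N)%N -> (K * N <= n)%N -> (F N <= K * C2 delta n)%N.
Proof.
move=> /(_ (0, 0) 1 ltr01)[K K0 KP]; exists K => // n N N0 KN.
have [X [S [[uS SP] sX FS]]] := KP N N0.
apply: leq_trans FS _; rewrite leq_mul2l; apply/orP; right.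
have n0 : (0 < n)%N by apply: leq_trans KN; rewrite muln_gt0 K0.
have sX' : (size (undup X) <= n)%N.
  by apply: leq_trans (size_undup X) (leq_trans sX KN).
have [p p_inj pX] := pad_points (undup_uniq X) sX'.
have /boolp.choice[f fP] : forall x, exists i, x \in X -> p i = x.
  move=> x; have [xX|xX] := boolP (x \in X); last by exists (Ordinal n0).
  by have [|i pi] := pX x; [rewrite mem_undup|exists i].
apply: leq_trans (nchains_le_C2 delta p_inj).
have szk : size (codom delta) = k by rewrite size_codom card_ord.
pose g (c : (R * R) * seq (R * R)) : {ffun 'I_k.+1 -> 'I_n} :=
  [ffun i : 'I_k.+1 => f (nth (0, 0) (c.1 :: c.2) i)].
have sz c : c \in S -> size (c.1 :: c.2) = k.+1.
  move=> cS; have [fo _ _ _ _] := SP c cS.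
  by rewrite /= (follows_size fo) size_map szk.
have pg c (i : 'I_k.+1) : c \in S -> p (g c i) = nth (0, 0) (c.1 :: c.2) i.
  move=> cS; rewrite ffunE fP //; have [_ _ cX _ _] := SP c cS.
  by apply: cX; rewrite mem_nth // sz.
have ug : uniq (map g S).
  rewrite map_inj_in_uniq // => c c' cS c'S gg.
  suff : c.1 :: c.2 = c'.1 :: c'.2 by case: (c) (c') => [? ?] [? ?] /= [-> ->].
  apply: (@eq_from_nth _ (0, 0)); first by rewrite !sz.
  move=> i; rewrite sz // => ik.
  by rewrite -(pg c (Ordinal ik) cS) -(pg c' (Ordinal ik) c'S) gg.
rewrite -(size_map g) -(card_uniqP ug); apply/subset_leq_card/fintype.subsetP.
move=> _ /mapP[c cS ->]; rewrite inE; have [fo un cX _ _] := SP c cS.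
apply/andP; split.
  apply/injectiveP => i j gij.
  have /eqP := etrans (esym (pg c i cS)) (etrans (congr1 p gij) (pg c j cS)).
  by rewrite nth_uniq ?sz // => /eqP/ord_inj.
apply/forallP => j.
have := @nth_follows _ _ _ _ (fun _ _ => true) (0, 0) j fo.
rewrite size_map szk => /(_ (ltn_ord j)).
rewrite !pg // !inordK ?ltnS //; last exact: ltnW.
rewrite (nth_map 0) ?szk // codomE (nth_map j) ?size_enum_ord //.
by have -> : nth j (enum 'I_k) j = j by apply: val_inj; rewrite /= nth_enum_ord.
Qed.

Lemma rich_nil : rich [::] id.
Proof.
move=> z eta eta0; exists 1%N => // N _; rewrite mul1n.
(* The denominators start at 2, so that the offsets stay strictly below [eta]. *)
pose f (i : nat) := (z.1, z.2 + eta / i.+2%:R).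
have f_inj : injective f.
  move=> i j [] /addrI/(mulfI _); rewrite gt_eqF // => /(_ isT)/invr_inj/eqP.
  by rewrite eqr_nat => /eqP[].
pose X := map f (iota 0 N).
have uX : uniq X by rewrite map_inj_uniq // iota_uniq.
have sX : size X = N by rewrite size_map size_iota.
exists X, [seq (x, [::]) | x <- X]; split; rewrite ?sX ?mul1n ?size_map ?size_iota //.
split; first by rewrite map_inj_uniq // => x y [].
move=> _ /mapP[x xX ->]; split=> //=.
- by move=> y; rewrite inE => /eqP->.
- move: xX => /mapP[i _ ->]; rewrite /f /= subrr normr0; split=> //.
  have i0 : (0 : R) < i.+2%:R by rewrite ltr0n.
  rewrite addrAC subrr add0r ger0_norm ?divr_ge0 // ?ltW //.
  by rewrite ltr_pdivrMr // ltr_pMr // ltr1n.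
- by move=> q; rewrite inE => /eqP->; move: xX => /mapP[i _ ->]; rewrite /f /= gerBl ltW.
Qed.

Lemma dist2_circle (x y u : R * R) d : 0 < d -> u.1 ^+ 2 + u.2 ^+ 2 = d ^+ 2 ->
  y = (x.1 + u.1, x.2 + u.2) -> (dist2 x y == d) * (dist2 y x == d).
Proof.
move=> d0 ud ->; have e : dist2 x (x.1 + u.1, x.2 + u.2) = d.
  by apply/(dist2_sqr _ _ (ltW d0)); rewrite /= -ud; ring.
by rewrite [dist2 _ x]dist2C e eqxx.
Qed.

(** All chains share the middle vertex [c]; its left neighbours lie near [z] and its right
    neighbours on an arc to the right, each chosen independently among N points. *)
Lemma rich_pair d1 d2 : 0 < d1 -> 0 < d2 -> rich [:: d1; d2] (fun N => N ^ 2)%N.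
Proof.
move=> d10 d20 z eta eta0; exists 3%N => // N N0.
have [P [uP sP] PP] := circle_points N d10 eta0.
have [Q [uQ sQ] QP] := circle_points N d20 (@ltr01 R).
pose c : R * R := (z.1 + 3 / 5 * d1, z.2 + 4 / 5 * d1).
pose left_ (u : R * R) : R * R := (c.1 - u.1, c.2 - u.2).
have leftK u : ((left_ u).1 + u.1, (left_ u).2 + u.2) = c.
  by rewrite /left_ /= !subrK.
pose right_ (u : R * R) : R * R := (c.1 + u.1, c.2 + u.2).
have left_inj : injective left_.
  by move=> [a b] [a' b'] [/addrI/oppr_inj-> /addrI/oppr_inj->].
have right_inj : injective right_ by move=> [a b] [a' b'] [/addrI-> /addrI->].
pose S := [seq (left_ u, [:: c; right_ v]) | u <- P, v <- Q].
exists (c :: map left_ P ++ map right_ Q), S; split.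
- split.
    apply: allpairs_uniq => // -[u v] [u' v'] _ _ /= [/addrI/oppr_inj e1 /addrI/oppr_inj e2].
    move=> /addrI e3 /addrI e4; congr pair; rewrite [LHS]surjective_pairing [RHS]surjective_pairing.
      by rewrite e1 e2.
    by rewrite e3 e4.
  move=> _ /allpairsP[[u v] [/= uin vin ->]] /=.
  have [u1 u2 u3 u4] := PP _ uin; have [v1 v2 _ _] := QP _ vin.
  split.
  - rewrite andbT; apply/andP; split.
      exact: (dist2_circle d10 u1 (esym (leftK u))).1.
    by rewrite (dist2_circle d20 v1 erefl).1.
  - rewrite !inE andbT negb_or -!andbA; apply/and3P; split; apply/eqP => /(congr1 fst);
      rewrite /left_ /right_ /=; lra.
  - have lP : left_ u \in map left_ P by exact: map_f.
    have rQ : right_ v \in map right_ Q by exact: map_f.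
    by move=> q; rewrite !inE mem_cat => /or3P[]/eqP->; rewrite ?eqxx ?lP ?rQ ?orbT.
  - rewrite /left_ /c /=.
    have -> : z.1 + 3 / 5 * d1 - u.1 - z.1 = - (u.1 - 3 / 5 * d1) by ring.
    have -> : z.2 + 4 / 5 * d1 - u.2 - z.2 = - (u.2 - 4 / 5 * d1) by ring.
    by rewrite !normrN.
  - move: u3; rewrite ltr_norml => /andP[u3 u3'].
    by move=> q; rewrite !inE => /or3P[]/eqP->; rewrite /left_ /right_ /c /=; lra.
- by rewrite /= size_cat !size_map sP sQ; lia.
- by rewrite size_allpairs sP sQ -mulnn; lia.
Qed.

(** The first vertex ranges over N points of a circle around [c], and the linkage joins [c] to the
    first point of every old chain by one new point [b]. The new points satisfy [left_ < c < b] in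
    abscissa and lie left of the old configuration, which gives distinctness. *)
Lemma rich_step d1 d2 d3 ds F : 0 < d1 -> 0 < d2 -> 0 < d3 ->
  rich ds F -> rich [:: d1, d2, d3 & ds] (fun N => N * F N)%N.
Proof.
move=> d10 d20 d30 richF z eta eta0.
have [eta1 eta10 link] := linkage d20 d30.
pose c : R * R := (z.1 + 3 / 5 * d1, z.2 + 4 / 5 * d1).
pose z1 : R * R := (c.1 + 4 / 5 * (d2 + d3), c.2 + 3 / 5 * (d3 - d2)).
have [K K0 KP] := richF z1 eta1 eta10.
exists (2 * K + 2)%N => [|N N0]; first by rewrite addn_gt0 orbT.
have [X [S [[uS SP] sX FS]]] := KP N N0.
have [P [uP sP] PP] := circle_points N d10 eta0.
have /boolp.choice[b bP] : forall v : R * R, exists b : R * R,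
    `|v.1 - z1.1| < eta1 -> `|v.2 - z1.2| < eta1 ->
    [/\ dist2 c b == d2, dist2 b v == d3, c.1 < b.1 & b.1 < z1.1 - eta1].
  move=> v; have [h1|h1] := ltP `|v.1 - z1.1| eta1; last by exists v.
  have [h2|h2] := ltP `|v.2 - z1.2| eta1; last by exists v.
  have [||b [b1 b2 b3 b4]] := link (v.1 - c.1, v.2 - c.2).
  - by move: h1; rewrite /z1 /= opprD addrA.
  - by move: h2; rewrite /z1 /= opprD addrA.
  exists (c.1 + b.1, c.2 + b.2) => _ _; split.
  - by rewrite (dist2_circle d20 b1 erefl).1.
  - rewrite (dist2_circle (u := (v.1 - c.1 - b.1, v.2 - c.2 - b.2)) d30 _ _).1 //=.
      by rewrite -b2 /=; ring.
    by rewrite [LHS]surjective_pairing; congr pair; ring.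
  - by rewrite /= ltrDl.
  - by rewrite /z1 /=; lra.
pose left_ (u : R * R) : R * R := (c.1 - u.1, c.2 - u.2).
have leftK u : ((left_ u).1 + u.1, (left_ u).2 + u.2) = c.
  by rewrite /left_ /= !subrK.
have left_inj : injective left_.
  by move=> [x y] [x' y'] [/addrI/oppr_inj-> /addrI/oppr_inj->].
pose S' := [seq (left_ u, [:: c, b s.1, s.1 & s.2]) | u <- P, s <- S].
exists (c :: map left_ P ++ X ++ map b X), S'; split.
- split.
    apply: allpairs_uniq => // -[u s] [u' s'] _ _ /= [/addrI/oppr_inj e1 /addrI/oppr_inj e2].
    move=> _ e3 e4; congr pair; rewrite [LHS]surjective_pairing [RHS]surjective_pairing.
      by rewrite e1 e2.
    by rewrite e3 e4.
  move=> _ /allpairsP[[u s] [/= uin sin ->]] /=.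
  have [u1 u2 u3 u4] := PP _ uin.
  have [fo un sX' [near1 near2] ge] := SP _ sin.
  have [b1 b2 b3 b4] := bP _ near1 near2.
  have lc : (left_ u).1 < c.1 by rewrite /left_ /= gtrBl.
  have notin q : q.1 < z1.1 - eta1 -> q \notin s.1 :: s.2.
    by move=> lt; apply/negP => /ge; rewrite leNgt lt.
  have neq (q r : R * R) : q.1 < r.1 -> q == r = false.
    by move=> lt; apply/eqP => e; move: lt; rewrite e ltxx.
  split.
  - by rewrite (dist2_circle d10 u1 (esym (leftK u))).1 b1 b2 fo.
  - move: un (notin (left_ u)) (notin c) (notin (b s.1)) => /= -> n1 n2 n3.
    rewrite 2!in_cons [in X in _ && X]in_cons !neq //=; last exact: lt_trans b3.
    by rewrite n1 ?n2 ?n3 //; [apply: lt_trans b4|apply: lt_trans lc (lt_trans b3 b4)].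
  - move=> q; rewrite 3!in_cons => /or4P[/eqP->|/eqP->|/eqP->|/sX' qX].
    + have lP : left_ u \in map left_ P by exact: map_f.
      by rewrite in_cons mem_cat lP orbT.
    + by rewrite mem_head.
    + have bX : b s.1 \in map b X by apply/map_f/sX'; rewrite mem_head.
      by rewrite in_cons !mem_cat bX !orbT.
    + by rewrite in_cons !mem_cat qX !orbT.
  - rewrite /left_ /c /=.
    have -> : z.1 + 3 / 5 * d1 - u.1 - z.1 = - (u.1 - 3 / 5 * d1) by ring.
    have -> : z.2 + 4 / 5 * d1 - u.2 - z.2 = - (u.2 - 4 / 5 * d1) by ring.
    by rewrite !normrN.
  - have lz : z.1 - eta <= (left_ u).1.
      by move: u3; rewrite ltr_norml => /andP[u3 u3']; rewrite /left_ /c /=; lra.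
    move=> q; rewrite 3!in_cons => /or4P[/eqP->//|/eqP->|/eqP->|/ge qX].
    + by apply: ltW; apply: le_lt_trans lz lc.
    + by apply: ltW; apply: le_lt_trans lz (lt_trans lc b3).
    + by apply: ltW; apply: le_lt_trans lz (lt_le_trans (lt_trans lc (lt_trans b3 b4)) qX).
- rewrite /= !size_cat !size_map sP.
  by move: sX N0; set m := (K * N)%N; rewrite mulnDl -mulnA -/m; lia.
- rewrite size_allpairs sP.
  apply: leq_trans (_ : N * (K * size S) <= _)%N; first by rewrite leq_mul2l FS orbT.
  by rewrite mulnCA leq_mul2r; apply/orP; right; lia.
Qed.

End RichChains.

Lemma pigeonhole_card (A J : finType) (S : {set A}) (f : A -> J) (j : J) :
  exists j0, (#|S| <= #|J| * #|[set x in S | f x == j0]|)%N.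
Proof.
have [j0 _ jmax] := @arg_maxnP J j predT (fun i => #|[set x in S | f x == i]|) isT.
exists j0; rewrite -sum1_card (partition_big f predT) //=.
rewrite -sum_nat_const; apply: leq_sum => i _.
by rewrite sum1dep_card; exact: jmax.
Qed.

(** * Folding a unit distance configuration into a small square *)

Section Folding.
Variable R : realType.

Definition fold_mod (L x : R) : R := x - L * (Num.floor (x / L))%:~R.

Lemma fold_modE (L x : R) : x = fold_mod L x + L * (Num.floor (x / L))%:~R.
Proof. by rewrite /fold_mod subrK. Qed.

Lemma fold_mod_itv (L x : R) : 0 < L -> 0 <= fold_mod L x < L.
Proof.
move=> L0; have /andP[f1 f2] := floor_itv (x / L); rewrite intrD in f2.
have e : L * (x / L) = x by rewrite mulrCA divff ?mulr1 // gt_eqF.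
have := ler_wpM2l (ltW L0) f1; have : L * (x / L) < L * ((Num.floor (x / L))%:~R + 1).
  by rewrite ltr_pM2l.
by rewrite e /fold_mod => h1 h2; apply/andP; split; lra.
Qed.

(** Two distinct coordinates are identified only if their difference is a positive multiple [m * L].
    As [L] exceeds [eta / 4], the multiplier [m] is bounded and only finitely many [L] are bad. *)
Lemma fold_mod_generic (T : finType) (x : T -> R) (eta : R) : 0 < eta ->
  exists s : seq R, forall L, eta / 4 < L -> L \notin s ->
    forall i j, fold_mod L (x i) = fold_mod L (x j) -> x i = x j.
Proof.
move=> eta0; pose Ds := [seq `|x ij.1 - x ij.2| | ij <- enum {: T * T}].
exists [seq D / m.+1%:R | D <- Ds, m <- iota 0 (Num.bound (4 * D / eta))].
move=> L Leta Lbad i j fij; have L0 : 0 < L by apply: lt_trans Leta; rewrite divr_gt0.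
pose m := `|Num.floor (x i / L) - Num.floor (x j / L)|%N.
have xx : `|x i - x j| = L * m%:R.
  rewrite {1}(fold_modE L (x i)) {1}(fold_modE L (x j)) fij opprD addrACA subrr add0r.
  by rewrite -mulrBr normrM gtr0_norm // -intrB -intr_norm /m -abszE.
case: m xx => [|m] xx.
  by apply/eqP; rewrite -subr_eq0 -normr_eq0 xx mulr0.
case/negP: Lbad; apply/allpairsPdep; exists `|x i - x j|, m; split.
- by apply/mapP; exists (i, j); rewrite ?mem_enum.
- rewrite mem_iota add0n /=.
  have le : m.+1%:R < 4 * `|x i - x j| / eta.
    rewrite xx ltr_pdivlMr //.
    have q0 : (0 : R) < m.+1%:R * (4 * L - eta) by rewrite mulr_gt0 ?ltr0n //; lra.
    by move: q0; move: (m.+1%:R) => w; lra.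
  have := lt_trans le (archi_boundP (ltW (le_lt_trans (ler0n R m.+1) le))).
  by rewrite ltr_nat; exact: ltnW.
- by rewrite xx mulfK // pnatr_eq0.
Qed.

(** Heads of edges are folded into a square of side [L] near [z]. A tail is folded in the same way
    and then shifted by the difference of the two lattice cells, which preserves the edge length.
    Only boundedly many cell differences occur, so a positive proportion of the edges uses one and
    the same shift. *)
Lemma rich_single (d : R) : 0 < d -> rich [:: d] (u2 R).
Proof.
move=> d0 z eta eta0.
(* Coordinates differing by at most [d] lie fewer than [M] cells apart, because [L > eta / 4]; the
   extra 2 pays for the positions within the cells. *)
pose M := (Num.bound (4 * d / eta)).+2.
pose J : finType := ('I_M.+1 * 'I_(2 * M).+1)%type.
have J0 : (0 < #|J|)%N by rewrite card_prod !card_ord.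
exists (#|J| + 2)%N => [|N N0]; first by rewrite addn_gt0 J0.
have [q q_inj qu] := u2_attained R N.
pose P i := ((q i).1 * d, (q i).2 * d).
have d_neq0 : d != 0 by rewrite gt_eqF.
have P_inj i j : (P i).1 = (P j).1 -> (P i).2 = (P j).2 -> i = j.
  move=> /(mulIf d_neq0) e1 /(mulIf d_neq0) e2; apply: q_inj.
  by rewrite [LHS]surjective_pairing e1 e2 -surjective_pairing.
have [s1 gen1] := fold_mod_generic (fun i => (P i).1) eta0.
have [s2 gen2] := fold_mod_generic (fun i => (P i).2) eta0.
have [|L /andP[L1 L2] Ls] := @avoid_finite R (s1 ++ s2) (eta / 4) (eta / 2); first by lra.
move: Ls; rewrite mem_cat negb_or => /andP[Ls1 Ls2].
have L0 : 0 < L by lra.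
pose fl x : int := Num.floor (x / L).
pose da (ij : 'I_N * 'I_N) : int := fl (P ij.2).1 - fl (P ij.1).1.
pose db (ij : 'I_N * 'I_N) : int := fl (P ij.2).2 - fl (P ij.1).2.
(* Each edge is oriented so that its horizontal shift is nonnegative; thus tails never lie left of
   the region of the heads. *)
pose A1 := [set ij | (dist2 (P ij.1) (P ij.2) == d) && (0 <= da ij)].
have distP i j : dist2 (q i) (q j) == 1 -> dist2 (P i) (P j) = d.
  move=> /eqP/(dist2_sqr _ _ ler01) e; apply/(dist2_sqr _ _ (ltW d0)).
  by rewrite /P /= -!mulrBl !exprMn -mulrDl e expr1n mul1r.
have u2A1 : (u2 R N <= #|A1|)%N.
  rewrite -qu /nunit.
  apply: (@leq_card_rel _ _ _ _ (fun ij c => c = ij \/ c = (ij.2, ij.1))).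
    move=> [i j]; rewrite inE /= => /andP[ij /distP e].
    have [le|lt] := lerP 0 (da (i, j)).
      by exists (i, j); [rewrite inE /= e eqxx|left].
    exists (j, i); last by right.
    rewrite inE /= dist2C e eqxx /=; move: lt; rewrite /da /=; lia.
  move=> [i j] [i' j'] c; rewrite !inE /= => /andP[ij _] /andP[ij' _].
  by case=> -> [[]|[]] e1 e2; move: ij ij'; rewrite e1 e2 //; lia.
(* The vertical shift may be negative and is moved by [M] into the range of an ordinal. *)
pose phi (ij : 'I_N * 'I_N) : J := (inord `|da ij|%N, inord `|(db ij + M%:Z)%R|%N).
have [j0 pg] := pigeonhole_card A1 phi (ord0, ord0).
set A2 := [set ij in A1 | phi ij == j0] in pg.
pose a0 : int := (j0.1 : nat)%:Z; pose b0 : int := (j0.2 : nat)%:Z - M%:Z.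
have diff_bound (x y : R) : (x - y) ^+ 2 <= d ^+ 2 -> `|fl y - fl x| < M%:Z.
  rewrite -norm_le_sqr ?(ltW d0) // => xy.
  have /andP[fx0 fx1] := fold_mod_itv x L0; have /andP[fy0 fy1] := fold_mod_itv y L0.
  rewrite -(ltr_int R) intr_norm intrB.
  have ex := fold_modE L x; have ey := fold_modE L y.
  rewrite -/(fl x) in ex; rewrite -/(fl y) in ey.
  have eL : `|(fl y)%:~R - (fl x)%:~R| * L < 2 * L + d.
    rewrite -[X in _ * X](gtr0_norm L0) -normrM mulrBl ![_ * L]mulrC.
    have -> : L * (fl y)%:~R - L * (fl x)%:~R
        = (fold_mod L x - fold_mod L y) - (x - y) by lra.
    apply: le_lt_trans (ler_normB _ _) _.
    have : `|fold_mod L x - fold_mod L y| < 2 * L by rewrite ltr_norml; lra.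
    by lra.
  have dL : d <= (4 * d / eta) * L.
    rewrite mulrAC ler_pdivlMr //.
    have : 0 < d * (4 * L - eta) by rewrite mulr_gt0 //; lra.
    lra.
  have bnd := archi_boundP (divr_ge0 (mulr_ge0 (ler0n R 4) (ltW d0)) (ltW eta0)).
  have : `|(fl y)%:~R - (fl x)%:~R| < 2 + 4 * d / eta.
    by rewrite -(ltr_pM2r L0) mulrDl; lra.
  have -> : (M%:Z)%:~R = (Num.bound (4 * d / eta))%:R + 2 :> R.
    by rewrite -[LHS]/(M%:R) /M -addn2 natrD.
  lra.
have A2P ij : ij \in A2 -> [/\ dist2 (P ij.1) (P ij.2) = d, da ij = a0 & db ij = b0].
  rewrite !inE => /andP[/andP[/eqP e a_ge0] /eqP ph]; split=> //.
    have le : (da ij)%R < M%:Z.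
      apply: le_lt_trans (ler_norm _) (diff_bound _ _ _).
      move/(dist2_sqr _ _ (ltW d0)): e => <-.
      by rewrite lerDl sqr_ge0.
    rewrite /a0 -ph /= inordK; first by lia.
    by lia.
  have le : `|db ij| < M%:Z.
    apply: diff_bound.
    move/(dist2_sqr _ _ (ltW d0)): e => <-.
    by rewrite lerDr sqr_ge0.
  rewrite /b0 -ph /= inordK; first by lia.
  by lia.
pose hd i := (z.1 + fold_mod L (P i).1, z.2 + fold_mod L (P i).2).
pose tl i := (z.1 + fold_mod L (P i).1 + L * a0%:~R, z.2 + fold_mod L (P i).2 + L * b0%:~R).
have hd_inj : injective hd.
  by move=> i j [/addrI/(gen1 _ L1 Ls1) e1 /addrI/(gen2 _ L1 Ls2) e2]; exact: P_inj.
pose S := [seq (hd ij.1, [:: tl ij.2]) | ij <- enum A2].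
exists (map hd (enum 'I_N) ++ map tl (enum 'I_N)), S; split.
- split.
    rewrite map_inj_uniq ?enum_uniq // => -[i j] [i' j'] /=.
    move=> [/addrI e1 /addrI e2 /addIr/addrI e3 /addIr/addrI e4].
    congr pair; apply: P_inj.
    - exact: gen1 _ L1 Ls1 _ _ e1.
    - exact: gen2 _ L1 Ls2 _ _ e2.
    - exact: gen1 _ L1 Ls1 _ _ e3.
    - exact: gen2 _ L1 Ls2 _ _ e4.
  move=> _ /mapP[[i j] ijA ->] /=; rewrite mem_enum in ijA.
  have [e ea eb] := A2P _ ijA; rewrite /= in e.
  have dht : dist2 (hd i) (tl j) = d.
    have coord (x y w : R) : w + fold_mod L x - (w + fold_mod L y + L * (fl y - fl x)%:~R) = x - y.
      rewrite intrB mulrBr; have := fold_modE L x; have := fold_modE L y.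
      by rewrite -/(fl x) -/(fl y); lra.
    rewrite -e /dist2 /hd /tl -ea -eb /da /db [_.1 in LHS]/= [_.2 in LHS]/=.
    by rewrite !coord.
  have /andP[f1 f1'] := fold_mod_itv (P i).1 L0.
  have /andP[f2 f2'] := fold_mod_itv (P i).2 L0.
  have /andP[f3 f3'] := fold_mod_itv (P j).1 L0.
  split.
  - by rewrite dht eqxx.
  - rewrite inE andbT; apply/eqP => ht; move: dht; rewrite ht => /(dist2_sqr _ _ (ltW d0)).
    by rewrite !subrr expr0n /= addr0 => /esym/eqP; rewrite expf_eq0 /= (negbTE d_neq0).
  - have hX : hd i \in map hd (enum 'I_N) by rewrite map_f ?mem_enum.
    have tX : tl j \in map tl (enum 'I_N) by rewrite map_f ?mem_enum.
    by move=> x; rewrite !inE mem_cat => /orP[]/eqP->; rewrite ?hX ?tX ?orbT.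
  - rewrite /hd /= [z.1 + _]addrC [z.2 + _]addrC !addrK !ger0_norm //; lra.
  - have La : 0 <= L * a0%:~R by rewrite mulr_ge0 ?(ltW L0) // ler0z.
    by move=> x; rewrite !inE => /orP[]/eqP->; rewrite /hd /tl /=; lra.
- have sz (f : 'I_N -> R * R) : size (map f (enum 'I_N)) = N by rewrite size_map size_enum_ord.
  by rewrite size_cat !sz mulnDl mul2n -addnn leq_addl.
- rewrite size_map -cardE; apply: leq_trans u2A1 (leq_trans pg _).
  by rewrite leq_mul2r leq_addr orbT.
Qed.

End Folding.

(** * Asymptotics *)

Section UnitDistances.
Variable R : realType.

Lemma u2_ge n : (n.-1 <= u2 R n)%N.
Proof.
case: n => [|m] //=.
apply: leq_trans (nunit_le_u2 (@integer_points_inj R m.+1)).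
pose f (i : 'I_m) : 'I_m.+1 * 'I_m.+1 := (widen_ord (leqnSn m) i, lift ord0 i).
have f_inj : injective f.
  by move=> i j /(congr1 (fun x => val x.1)) /= /val_inj.
rewrite -[X in (X <= _)%N](card_ord m) -(card_imset _ f_inj).
apply/subset_leq_card/fintype.subsetP => _ /imsetP[i _ ->].
rewrite inE /= ltnSn /=; apply/eqP/(dist2_sqr _ _ ler01) => /=.
rewrite /bump /= add1n -natr1 subrr expr0n /= addr0 opprD addrA subrr add0r.
by rewrite sqrrN.
Qed.

Lemma nunit_subset n (p : 'I_n -> R * R) (W : {set 'I_n}) N : injective p -> (#|W| <= N)%N ->
  (#|[set ij : 'I_n * 'I_n | [&& (ij.1 < ij.2)%N, dist2 (p ij.1) (p ij.2) == 1%R,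
        ij.1 \in W & ij.2 \in W]]| <= u2 R N)%N.
Proof.
move=> p_inj WN; pose X := [seq p i | i <- enum W].
have uX : uniq X by rewrite map_inj_uniq // enum_uniq.
have sX : (size X <= N)%N by rewrite size_map -cardE.
have [p' p'_inj p'X] := pad_points uX sX.
have [N0|N0] := posnP N.
  move: WN; rewrite N0 leqn0 cards_eq0 => /eqP->.
  by rewrite [X in (X <= _)%N](_ : _ = 0%N) //; apply/eqP; rewrite cards_eq0;
    apply/eqP/setP => x; rewrite !inE !andbF.
have /boolp.choice[f fP] : forall i, exists j, i \in W -> p' j = p i.
  move=> i; have [iW|iW] := boolP (i \in W); last by exists (Ordinal N0).
  by have [|j pj] := p'X (p i); [rewrite map_f ?mem_enum|exists j].
have f_inj i j : i \in W -> j \in W -> f i = f j -> i = j.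
  by move=> iW jW fij; apply: p_inj; rewrite -!fP // fij.
apply: leq_trans (nunit_le_u2 p'_inj).
apply: (@leq_card_rel _ _ _ _
  (fun ij c => c = (f ij.1, f ij.2) \/ c = (f ij.2, f ij.1))).
  move=> [i j]; rewrite inE /= => /and4P[ij d iW jW].
  have [lt|lt|/val_inj e] := ltngtP (f i) (f j).
  - by exists (f i, f j); [rewrite inE /= lt !fP|left].
  - by exists (f j, f i); [rewrite inE /= lt !fP // dist2C|right].
  - by move: ij; rewrite (f_inj _ _ iW jW e) ltnn.
move=> [i j] [i' j'] c; rewrite !inE /= => /and4P[ij _ iW jW] /and4P[ij' _ iW' jW'].
case=> -> [[e1 e2]|[e1 e2]].
- by rewrite (f_inj _ _ iW iW' e1) (f_inj _ _ jW jW' e2).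
- have e3 := f_inj _ _ iW jW' e1; have e4 := f_inj _ _ jW iW' e2.
  by move: ij ij'; rewrite e3 e4 => h1 h2; have := ltn_trans h1 h2; rewrite ltnn.
- have e3 := f_inj _ _ jW iW' e1; have e4 := f_inj _ _ iW jW' e2.
  by move: ij ij'; rewrite e3 e4 => h1 h2; have := ltn_trans h1 h2; rewrite ltnn.
- by rewrite (f_inj _ _ iW iW' e2) (f_inj _ _ jW jW' e1).
Qed.

Lemma card_residue n G (a : nat) : (#|[set i : 'I_n | i %% G.+1 == a]| <= (n %/ G.+1).+1)%N.
Proof.
have <- : #|[set: 'I_(n %/ G.+1).+1]| = (n %/ G.+1).+1 by rewrite cardsT card_ord.
apply: (@leq_card_rel _ _ _ _ (fun (i : 'I_n) (c : 'I_(n %/ G.+1).+1) => (c : nat) = i %/ G.+1)%N).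
  move=> i _; have lt : (i %/ G.+1 < (n %/ G.+1).+1)%N by rewrite ltnS leq_div2r // ltnW.
  by exists (Ordinal lt).
move=> i j c; rewrite !inE => /eqP ia /eqP ja ci cj; apply: ord_inj.
by rewrite (divn_eq i G.+1) (divn_eq j G.+1) ia ja -ci -cj.
Qed.

(** The construction only has n/K points, while the claim involves [u2] at n. Indices are split into
    4M residue classes; some pair of classes carries a fixed proportion of the unit distances, and
    two classes together have at most n/M points. *)
Lemma u2_subsample n M : (0 < M)%N -> (4 * M <= n)%N ->
  (u2 R n <= (4 * M) ^ 2 * u2 R (n %/ M))%N.
Proof.
move=> M0 nM; have [p p_inj <-] := u2_attained R n.
have [G GM] : exists G, (4 * M = G.+1)%N by exists (4 * M).-1; lia.
pose g (i : 'I_n) : 'I_G.+1 := inord (i %% G.+1).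
have gE i : val (g i) = (i %% G.+1)%N by rewrite /= inordK // ltn_mod.
have [[a b]] := pigeonhole_card
  [set ij : 'I_n * 'I_n | (ij.1 < ij.2)%N && (dist2 (p ij.1) (p ij.2) == 1%R)]
  (fun ij => (g ij.1, g ij.2)) (ord0, ord0).
rewrite card_prod card_ord mulnn => h; rewrite GM; apply: leq_trans h _.
rewrite leq_mul2l; apply/orP; right.
pose cl (c : 'I_G.+1) := [set i : 'I_n | i %% G.+1 == c]%N.
have WN : (#|cl a :|: cl b| <= n %/ M)%N.
  apply: leq_trans (leq_card_setU _ _) _.
  apply: leq_trans (leq_add (card_residue _ _ _) (card_residue _ _ _)) _.
  rewrite -GM (mulnC 4) divnMA.
  have : (4 <= n %/ M)%N by rewrite leq_divRL.
  by move: (n %/ M)%N => x; lia.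
apply: leq_trans (nunit_subset p_inj WN); apply/subset_leq_card/fintype.subsetP => -[i j].
rewrite !inE /= => /andP[/andP[-> ->] /eqP[ea eb]] /=.
by rewrite -ea -eb !gE !eqxx orbT.
Qed.

End UnitDistances.

Section LowerBound.
Variable R : realType.

(** The base cases are realised by [rich_nil], [rich_single] and [rich_pair], the recursion by
    [rich_step]. *)
Fixpoint chain_target (m N : nat) : nat :=
  match m with
  | 0 => N
  | 1 => u2 R N
  | 2 => N ^ 2
  | m'.+3 => N * chain_target m' N
  end.

Lemma rich_chain_target (ds : seq R) : {in ds, forall d, 0 < d} ->
  rich ds (chain_target (size ds)).
Proof.
elim: {ds}_.+1 {-2}ds (ltnSn (size ds)) => // n IH [|d1 [|d2 [|d3 ds]]] sz dpos.
- exact: rich_nil.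
- by apply: rich_single; apply: dpos; rewrite mem_head.
- by apply: rich_pair; apply: dpos; rewrite !inE eqxx ?orbT.
- apply: rich_step; try by apply: dpos; rewrite !inE eqxx ?orbT.
  apply: IH => [|d dd]; first by move: sz => /=; lia.
  by apply: dpos; rewrite !inE dd !orbT.
Qed.

Lemma chain_targetE m N :
  chain_target m N = (N ^ (m %/ 3) * chain_target (m %% 3) N)%N.
Proof.
elim/ltn_ind: m => -[|[|[|m]]] IH; try by rewrite /= expn0 mul1n.
rewrite [LHS]/= IH; last by lia.
have -> : (m.+3 %/ 3 = (m %/ 3).+1)%N by lia.
have -> : (m.+3 %% 3 = m %% 3)%N by lia.
by rewrite expnS mulnA.
Qed.

Lemma walk_targetE m (n U : R) :
  walk_target m n U = n ^+ (m %/ 3) * walk_target (m %% 3) n U.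
Proof.
elim/ltn_ind: m => -[|[|[|m]]] IH; try by rewrite /= expr0 mul1r.
rewrite [LHS]/= IH; last by lia.
have -> : (m.+3 %/ 3 = (m %/ 3).+1)%N by lia.
have -> : (m.+3 %% 3 = m %% 3)%N by lia.
by rewrite exprS mulrA.
Qed.

Lemma C2_lower k (delta : 'I_k -> R) : (forall j, 0 < delta j) ->
  exists2 K : nat, (0 < K)%N & forall n, (K <= n)%N ->
    (chain_target k (n %/ K) <= K * C2 delta n)%N.
Proof.
move=> d0; have dpos : {in codom delta, forall d, 0 < d} by move=> d /codomP[j ->].
have := rich_chain_target dpos; rewrite size_codom card_ord => /rich_C2[K K0 KP].
exists K => // n Kn; apply: KP; first by rewrite divn_gt0.
by rewrite mulnC leq_trunc_div.
Qed.

Lemma leq_double_div n K : (0 < K)%N -> (K <= n)%N -> (n <= 2 * K * (n %/ K))%N.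
Proof.
move=> K0 Kn; have := ltn_ceil n K0; have : (0 < n %/ K)%N by rewrite divn_gt0.
by move: (n %/ K)%N => x; nia.
Qed.

End LowerBound.

Section Logarithms.
Variable R : realType.

Lemma ln_nat_ge1 : exists N : nat, forall n, (N <= n)%N -> 1 <= ln (n%:R : R).
Proof.
exists (Num.bound (expR 1 : R)) => n Nn.
have e0 : (0 : R) < expR 1 := expR_gt0 _.
have le : expR 1 <= n%:R :> R.
  by apply: le_trans (ltW (archi_boundP (ltW e0))) _; rewrite ler_nat.
by rewrite -[leLHS]expRK ler_ln ?posrE // (lt_le_trans e0).
Qed.

Lemma trunc_log_le_ln : exists2 A : R, 0 < A & forall n,
  1 <= ln (n%:R : R) -> ((trunc_log 2 n).+1)%:R <= A * ln (n%:R : R).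
Proof.
have l2 : 0 < ln (2 : R) by rewrite ln_gt0 // ltr1n.
exists ((ln 2)^-1 + 1) => [|n ln1]; first by rewrite addr_gt0 // invr_gt0.
have n0 : (0 < n)%N.
  by case: n ln1 => // ; rewrite ln0 // => h; have := lt_le_trans ltr01 h; rewrite ltxx.
have le : (trunc_log 2 n)%:R * ln 2 <= ln (n%:R : R).
  rewrite mulr_natl -lnXn ?ltr0n // ler_ln ?posrE ?exprn_gt0 ?ltr0n //.
  by rewrite -natrX ler_nat; case/andP: (trunc_log_bounds (isT : (1 < 2)%N) n0).
rewrite -natr1 mulrDl mul1r; apply: lerD => //.
by rewrite mulrC ler_pdivlMr.
Qed.

(** Apply ln y < y to y = n^(eps/k) and raise the result to the power k. *)
Lemma ln_pow_le_powR k (eps : R) : (0 < k)%N -> 0 < eps ->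
  exists2 B : R, 0 < B & forall n, (0 < n)%N -> 1 <= ln (n%:R : R) ->
    ln (n%:R : R) ^+ k <= B * (n%:R : R) `^ eps.
Proof.
move=> k0 eps0; have k0' : (0 : R) < k%:R by rewrite ltr0n.
exists ((k%:R / eps) ^+ k) => [|n n0 ln1]; first by rewrite exprn_gt0 // divr_gt0.
have n0' : (0 : R) < n%:R by rewrite ltr0n.
have -> : (n%:R : R) `^ eps = (n%:R `^ (eps / k%:R)) ^+ k.
  by rewrite -powR_mulrn ?powR_ge0 // -powRrM divfK // gt_eqF.
rewrite -exprMn; apply: lerXn2r; rewrite ?nnegrE.
- exact: le_trans ler01 ln1.
- by rewrite mulr_ge0 ?powR_ge0 // divr_ge0 // ltW.
have := ltW (ln_sublinear (powR_gt0 (eps / k%:R) n0')); rewrite ln_powR => le.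
have ke0 : 0 < k%:R / eps by rewrite divr_gt0.
rewrite -(ler_pM2l ke0) in le; apply: le_trans le.
have -> : k%:R / eps * (eps / k%:R * ln n%:R) = ln n%:R :> R.
  by field; rewrite !gt_eqF.
by [].
Qed.

End Logarithms.

Theorem theorem1p3 (R : realType) (k : nat) (delta : 'I_k -> R) :
  (1 <= k)%N -> (forall j, 0 < delta j) ->
  ((k %% 3 = 0 \/ k %% 3 = 2)%N ->
     softTheta (fun n => (C2 delta n)%:R)
               (fun n => (n%:R : R) ^+ (k.+1 %/ 3).+1)) /\
  ((k %% 3 = 1)%N ->
     isBigO (fun n => (n%:R : R) ^+ (k %/ 3) * (u2 R n)%:R)
          (fun n => (C2 delta n)%:R) /\
     (forall eps : R, 0 < eps ->
        isBigO (fun n => (C2 delta n)%:R)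
             (fun n => (n%:R : R) `^ ((k %/ 3)%:R + eps) * (u2 R n)%:R))).
Proof.
move=> k0 d0.
have [C C0 CP] := C2_upper d0.
have [K K0 KP] := C2_lower d0.
have [N1 N1P] := ln_nat_ge1 R.
have [A A0 AP] := trunc_log_le_ln R.
have log_pow n : 1 <= ln (n%:R : R) ->
    ((trunc_log 2 n).+1)%:R ^+ k <= A ^+ k * ln (n%:R : R) ^+ k.
  move=> ln1; rewrite -exprMn lerXn2r ?nnegrE ?AP //.
  by rewrite mulr_ge0 ?(ltW A0) // (le_trans ler01).
split=> k3.
  have [te we] : (forall N, chain_target R k N = N ^ (k.+1 %/ 3).+1)%N /\
      forall n U : R, walk_target k n U = n ^+ (k.+1 %/ 3).+1.
    split=> [N|n U].
      rewrite chain_targetE; case: k3 => k3; rewrite k3 /= -?expnSr -?expnD.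
        by congr (_ ^ _)%N; lia.
      by congr (_ ^ _)%N; lia.
    rewrite walk_targetE; case: k3 => k3; rewrite k3 /= -?exprSr -?exprD.
      by congr (_ ^+ _); lia.
    by congr (_ ^+ _); lia.
  set e := (k.+1 %/ 3).+1 in te we *; split.
    (* One power of the logarithm per edge of the chain. *)
    exists k%:R, (C * A ^+ k); split; first by rewrite ltr0n.
    split; first by rewrite mulr_gt0 // exprn_gt0.
    exists (maxn N1 1) => n; rewrite geq_max => /andP[n1 n0].
    have ln1 := N1P _ n1; rewrite powR_mulrn; last exact: le_trans ler01 ln1.
    apply: le_trans (CP n n0) _; rewrite we ler_wpM2r ?exprn_ge0 //.
    by rewrite -mulrA ler_pM2l // log_pow.
  (* The construction loses no logarithm; since the logarithm is eventually at least 1, the exponent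
     1 only weakens the bound. *)
  exists 1, ((2 * K)%:R ^+ e * K%:R); split; first exact: ltr01.
  split; first by rewrite mulr_gt0 ?exprn_gt0 ?ltr0n // muln_gt0.
  exists (maxn N1 K) => n; rewrite geq_max => /andP[n1 nK].
  have ln1 := N1P _ n1; rewrite powRr1; last exact: le_trans ler01 ln1.
  have le : (n ^ e <= (2 * K) ^ e * (K * C2 delta n))%N.
    apply: leq_trans (_ : (2 * K * (n %/ K)) ^ e <= _)%N.
      by rewrite leq_exp2r // leq_double_div.
    by rewrite expnMn leq_mul2l -(te (n %/ K)%N) KP ?orbT.
  move: le; rewrite -(ler_nat R) (natrM _ ((2 * K) ^ e)) (natrM _ K) (natrX _ n).
  rewrite (natrX _ (2 * K)%N) => /le_trans; apply.
  rewrite -!mulrA ler_pM2l ?exprn_gt0 ?ltr0n ?muln_gt0 // ler_pM2l ?ltr0n //.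
  by rewrite ler_peMl.
have te N : chain_target R k N = (N ^ (k %/ 3) * u2 R N)%N by rewrite chain_targetE k3.
have we (n U : R) : walk_target k n U = n ^+ (k %/ 3) * U by rewrite walk_targetE k3.
set q := (k %/ 3)%N in te we *; split.
  exists ((2 * K)%:R ^+ q * (4 * K)%:R ^+ 2 * K%:R).
  split; first by rewrite !mulr_gt0 ?exprn_gt0 ?ltr0n ?muln_gt0.
  exists (4 * K)%N => n nK.
  have nK' : (K <= n)%N by apply: leq_trans nK; rewrite leq_pmull.
  have le : (n ^ q * u2 R n <= (2 * K) ^ q * (4 * K) ^ 2 * (K * C2 delta n))%N.
    apply: leq_trans (leq_mul (_ : _ <= (2 * K * (n %/ K)) ^ q)%N (u2_subsample R K0 nK)) _.
      (* The exponent [q] is 0 for k = 1, where monotonicity of powers of the base has to be treated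
         apart. *)
      by case: (q) => // q'; rewrite leq_exp2r // leq_double_div.
    by rewrite expnMn mulnACA leq_mul2l -te KP ?orbT.
  move: le; rewrite -(ler_nat R) (natrM _ (n ^ q)%N) (natrM _ ((2 * K) ^ q * _)%N).
  rewrite (natrM _ ((2 * K) ^ q)%N) (natrM _ K) (natrX _ n) (natrX _ (2 * K)%N).
  by rewrite (natrX _ (4 * K)%N) !mulrA.
move=> eps eps0; have [B B0 BP] := ln_pow_le_powR k0 eps0.
exists (C * (A ^+ k * B) * 4); split; first by rewrite !mulr_gt0 // exprn_gt0.
exists (maxn N1 2) => n; rewrite geq_max => /andP[n1 n2].
have n0 : (0 < n)%N by exact: ltnW.
have n0' : (0 : R) < n%:R by rewrite ltr0n.
have ln1 := N1P _ n1.
apply: le_trans (CP n n0) _; rewrite we.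
(* Collinear points give at least n-1 unit distances, so for n >= 2 the summand n in U is absorbed
   and U <= 4 u2(n). *)
have u2n : n%:R <= 2 * (u2 R n)%:R :> R.
  have := u2_ge R n; rewrite -[_ * _ in leRHS]natrM ler_nat; lia.
have lp := log_pow _ ln1; have bp := BP _ n0 ln1.
have pD : (n%:R : R) `^ (q%:R + eps) = n%:R ^+ q * n%:R `^ eps.
  by rewrite powRD ?powR_mulrn ?ltW //; apply/implyP => _; rewrite gt_eqF.
rewrite pD.
apply: le_trans (_ : C * (A ^+ k * (B * n%:R `^ eps)) * (n%:R ^+ q * (4 * (u2 R n)%:R)) <= _).
  apply: ler_pM.
  - by rewrite mulr_ge0 ?(ltW C0) // exprn_ge0.
  - by rewrite mulr_ge0 ?exprn_ge0 // addr_ge0 ?mulr_ge0.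
  - rewrite ler_pM2l //; apply: le_trans lp _; rewrite ler_pM2l ?exprn_gt0 //.
  - by rewrite ler_wpM2l ?exprn_ge0 //; lra.
by rewrite le_eqVlt; apply/orP; left; apply/eqP; ring.
Qed.
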